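(* Let $K$ be a tame knot in the 3-sphere $\mathbb{S}^3$ and let $G(K) = \pi_1(\mathbb{S}^3 \setminus K)$ be its knot group. Then there is a non-trivial skew left brace whose additive group is $G(K)$; that is, there is an operation $\circ$ on the set $G(K)$, different from the group operation $\cdot$ of $G(K)$, such that $(G(K), \cdot, \circ)$ is a skew left brace.
   Context: A skew left brace is a triple $(G, \cdot, \circ)$ where $(G,\cdot)$ (the additive group) and $(G,\circ)$ (the multiplicative group) are groups and $g_1 \circ (g_2 \cdot g_3) = (g_1 \circ g_2)\cdot g_1^{-1} \cdot (g_1 \circ g_3)$ for all $g_1,g_2,g_3 \in G$, where $g_1^{-1}$ is the inverse in $(G,\cdot)$. It is non-trivial if $\cdot$ and $\circ$ do not coincide. *)

(* Defs.v *)
From HB Require Import structures.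
From mathcomp Require Import all_boot all_order all_algebra.
From mathcomp Require Import generic_quotient.
From mathcomp Require Import all_classical all_reals all_analysis.
From mathcomp Require Import wedge_sigT continuous_path.
From mathcomp Require Import ring lra.

Set Implicit Arguments.
Unset Strict Implicit.
Unset Printing Implicit Defensive.

Import Order.TTheory GRing.Theory Num.Theory.
Import numFieldNormedType.Exports.

Local Open Scope classical_set_scope.
Local Open Scope ring_scope.
Local Open Scope quotient_scope.

Definition is_group_law (G : Type) (op : G -> G -> G) : Prop :=
  associative op /\
  exists (e : G) (inv : G -> G),
    [/\ left_id e op, right_id e op, left_inverse e inv op &
        right_inverse e inv op].

(* The additive group is the groupType [G], written multiplicatively. *)
Definition skew_left_brace (G : groupType) (circ : G -> G -> G) : Prop :=
  is_group_law circ /\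
  forall g1 g2 g3 : G,
    circ g1 (g2 * g3)%g = (circ g1 g2 * g1^-1 * circ g1 g3)%g.

Definition nontrivial_skew_left_brace (G : groupType) (circ : G -> G -> G) :
    Prop :=
  skew_left_brace circ /\ ~ (forall g h : G, circ g h = (g * h)%g).

Section continuity.
Context {R : realType}.

Lemma continuous_maxr (T : topologicalType) (f g : T -> R) :
  continuous f -> continuous g -> continuous (fun x => Num.max (f x) (g x)).
Proof.
move=> cf cg; under eq_fun => x do rewrite maxr_absE.
move=> x; apply: cvgM; last exact: cvg_cst.
apply: cvgD; first by apply: cvgD; [exact: cf | exact: cg].
by apply: cvg_norm; apply: cvgB; [exact: cf | exact: cg].
Qed.

Lemma continuous_minr (T : topologicalType) (f g : T -> R) :
  continuous f -> continuous g -> continuous (fun x => Num.min (f x) (g x)).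
Proof.
move=> cf cg; under eq_fun => x do rewrite minr_absE.
move=> x; apply: cvgM; last exact: cvg_cst.
apply: cvgB; first by apply: cvgD; [exact: cf | exact: cg].
by apply: cvg_norm; apply: cvgB; [exact: cf | exact: cg].
Qed.

Lemma continuous_pair (T U V : topologicalType) (f : T -> U) (g : T -> V) :
  continuous f -> continuous g -> continuous (fun x => (f x, g x)).
Proof. by move=> cf cg x; apply: (cvg_pair (cf x) (cg x)). Qed.

Lemma continuous_compose (T U V : topologicalType) (f : T -> U) (g : U -> V) :
  continuous f -> continuous g -> continuous (fun x => g (f x)).
Proof. by move=> cf cg x; apply: continuous_comp; [exact: cf | exact: cg]. Qed.

Lemma continuous_paste (T U : topologicalType) (u : T -> R) (c : R)
    (F G : T -> U) :
  continuous u -> continuous F -> continuous G ->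
  (forall x, u x = c -> F x = G x) ->
  continuous (fun x => if u x <= c then F x else G x).
Proof.
move=> cu cF cG FG.
set h := fun x => _.
have hF x : u x <= c -> h x = F x by rewrite /h => ->.
have hG x : c <= u x -> h x = G x.
  rewrite /h; case: ifPn => // ux cx; apply: FG.
  by apply/eqP; rewrite eq_le ux.
pose A := u @^-1` [set r | r <= c].
pose B := u @^-1` [set r | c <= r].
have cA : closed A by apply: closed_comp => [x _|]; [exact: cu | exact: closed_le].
have cB : closed B by apply: closed_comp => [x _|]; [exact: cu | exact: closed_ge].
have AB : A `|` B = [set: T].
  by apply/seteqP; split=> // x _; have [|/ltW] := leP (u x) c; [left | right].
suff : {within A `|` B, continuous h}.
  by rewrite AB => ch; apply/continuous_subspace_setT.
apply: withinU_continuous => //.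
- apply: (@subspace_eq_continuous _ A U F h); last exact: continuous_subspaceT.
  by move=> x; rewrite inE => /hF ->.
- apply: (@subspace_eq_continuous _ B U G h); last exact: continuous_subspaceT.
  by move=> x; rewrite inE => /hG ->.
Qed.

End continuity.

Section unit_interval.
Context {R : realType}.

Definition unit_interval : Type := `[0, 1]%classic : set R.

HB.instance Definition _ := Topological.on unit_interval.

Definition ival (t : unit_interval) : R := set_val t.

Lemma clamp_subproof (r : R) : Num.max 0 (Num.min r 1) \in `[0, 1]%classic.
Proof.
rewrite inE /= in_itv /= le_max lexx /= ge_max ler01 /=.
by rewrite ge_min lexx orbT.
Qed.

Definition clamp (r : R) : unit_interval :=
  exist (fun x => x \in `[0, 1]%classic) _ (clamp_subproof r).

Lemma ival_ge0 t : 0 <= ival t.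
Proof. by have /= := set_valP t; rewrite in_itv /= => /andP[]. Qed.

Lemma ival_le1 t : ival t <= 1.
Proof. by have /= := set_valP t; rewrite in_itv /= => /andP[]. Qed.

Lemma ival_inj : injective ival.
Proof. exact: val_inj. Qed.

Lemma ivalK : cancel ival clamp.
Proof.
move=> t; apply: ival_inj; rewrite /ival /clamp set_valE /=.
by rewrite (min_idPl (ival_le1 t)) (max_idPr (ival_ge0 t)).
Qed.

Lemma clampK (r : R) : 0 <= r <= 1 -> ival (clamp r) = r.
Proof.
move=> /andP[r0 r1]; rewrite /ival /clamp set_valE /=.
by rewrite (min_idPl r1) (max_idPr r0).
Qed.

Lemma unit_interval_neq : clamp 0 != clamp 1.
Proof.
apply/eqP => /(congr1 ival); rewrite !clampK ?lexx ?ler01 // => /eqP.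
by rewrite eq_sym oner_eq0.
Qed.

HB.instance Definition _ :=
  @isBiPointed.Build unit_interval (clamp 0) (clamp 1) unit_interval_neq.

Lemma ival_continuous : continuous ival.
Proof. exact: initial_continuous. Qed.

Lemma clamp_continuous : continuous clamp.
Proof.
apply: continuous_comp_initial.
apply: continuous_maxr; first by move=> x; exact: cvg_cst.
by apply: continuous_minr => x; [exact: cvg_id | exact: cvg_cst].
Qed.

End unit_interval.
Arguments unit_interval R : clear implicits.

Section fundamental_group.
Context {R : realType} {X : topologicalType}.
Local Notation I := (unit_interval R).

(* In [H (s, t)], [s] is the deformation parameter and [t] the path parameter. *)
Definition path_homotopy (x y : X) (f g : {path I from x to y})
    (H : I * I -> X) : Prop :=
  [/\ continuous H,
      forall t, H (zero, t) = f t,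
      forall t, H (one, t) = g t,
      forall s, H (s, zero) = x &
      forall s, H (s, one) = y].

Definition path_homotopic (x y : X) (f g : {path I from x to y}) : Prop :=
  exists H, path_homotopy f g H.

Lemma ival_zero : ival (zero : I) = 0.
Proof. by rewrite clampK // lexx ler01. Qed.

Lemma ival_one : ival (one : I) = 1.
Proof. by rewrite clampK // lexx ler01. Qed.

Lemma clamp_zero : clamp 0 = zero :> I. Proof. by []. Qed.
Lemma clamp_one : clamp 1 = one :> I. Proof. by []. Qed.

Lemma clamp_le0 (r : R) : r <= 0 -> clamp r = zero.
Proof.
move=> r0; apply: ival_inj; rewrite ival_zero /ival /clamp set_valE /=.
by rewrite (min_idPl (le_trans r0 ler01)) (max_idPl r0).
Qed.

Lemma clamp_ge1 (r : R) : 1 <= r -> clamp r = one.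
Proof.
move=> r1; apply: ival_inj; rewrite ival_one /ival /clamp set_valE /=.
by rewrite (min_idPr r1) (max_idPr ler01).
Qed.

Lemma continuous_clamp (T : topologicalType) (phi : T -> R) :
  continuous phi -> continuous (fun t => clamp (phi t)).
Proof. by move=> cphi; apply: continuous_compose cphi clamp_continuous. Qed.

Lemma continuous_path (x y : X) (f : {path I from x to y})
    (T : topologicalType) (phi : T -> R) :
  continuous phi -> continuous (fun t => f (clamp (phi t))).
Proof.
by move=> /continuous_clamp cphi; apply: continuous_compose cphi (@cts_fun _ _ f).
Qed.

Lemma ival_fst_continuous : continuous (fun p : I * I => ival p.1).
Proof. exact: continuous_compose (fun _ => cvg_fst) ival_continuous. Qed.

Lemma ival_snd_continuous : continuous (fun p : I * I => ival p.2).
Proof. exact: continuous_compose (fun _ => cvg_snd) ival_continuous. Qed.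

Lemma path_homotopic_refl (x y : X) (f : {path I from x to y}) :
  path_homotopic f f.
Proof.
exists (fun p => f p.2); split => //= [|_|_]; rewrite ?path_zero ?path_one //.
exact: continuous_compose (fun _ => cvg_snd) (@cts_fun _ _ f).
Qed.

Lemma compl_continuous (T : topologicalType) (phi : T -> R) :
  continuous phi -> continuous (fun t => 1 - phi t).
Proof. by move=> cphi t; apply: cvgB; [exact: cvg_cst | exact: cphi]. Qed.

Lemma path_homotopic_sym (x y : X) (f g : {path I from x to y}) :
  path_homotopic f g -> path_homotopic g f.
Proof.
move=> [H [cH H0 H1 Hz Ho]].
exists (fun p => H (clamp (1 - ival p.1), p.2)); split => /= [|t|t|s|s].
- apply: continuous_compose cH; apply: continuous_pair => [|p]; last exact: cvg_snd.
  exact/continuous_clamp/compl_continuous/ival_fst_continuous.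
- by rewrite ival_zero subr0 clamp_one H1.
- by rewrite ival_one subrr clamp_zero H0.
- exact: Hz.
- exact: Ho.
Qed.

Lemma double_continuous (T : topologicalType) (phi : T -> R) :
  continuous phi -> continuous (fun t => phi t * 2).
Proof. by move=> cphi t; apply: cvgM; [exact: cphi | exact: cvg_cst]. Qed.

Lemma double_sub1_continuous (T : topologicalType) (phi : T -> R) :
  continuous phi -> continuous (fun t => phi t * 2 - 1).
Proof.
move=> cphi t; apply: cvgB; last exact: cvg_cst.
exact: double_continuous.
Qed.

Lemma half_double (r : R) : r = 2^-1 -> r * 2 = 1.
Proof. by move=> ->; rewrite mulVf // pnatr_eq0. Qed.

Lemma path_homotopic_trans (x y : X) (f g h : {path I from x to y}) :
  path_homotopic f g -> path_homotopic g h -> path_homotopic f h.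
Proof.
move=> [H [cH H0 H1 Hz Ho]] [K [cK K0 K1 Kz Ko]].
exists (fun p => if ival p.1 <= 2^-1 then H (clamp (ival p.1 * 2), p.2)
                 else K (clamp (ival p.1 * 2 - 1), p.2)).
split => /= [|t|t|s|s].
- apply: continuous_paste.
  + exact: ival_fst_continuous.
  + apply: continuous_compose cH.
    apply: continuous_pair => [|p]; last exact: cvg_snd.
    exact/continuous_clamp/double_continuous/ival_fst_continuous.
  + apply: continuous_compose cK.
    apply: continuous_pair => [|p]; last exact: cvg_snd.
    exact/continuous_clamp/double_sub1_continuous/ival_fst_continuous.
  + by move=> p /half_double ->; rewrite subrr clamp_zero clamp_one H1 K0.
- by rewrite ival_zero invr_ge0 ler0n mul0r clamp_zero.
- rewrite ival_one ifF; last by apply/negbTE; rewrite -ltNge invf_lt1 ?ltr1n.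
  by rewrite mul1r (_ : 2 - 1 = 1 :> R) ?clamp_one //; ring.
- by case: ifP.
- by case: ifP.
Qed.

Definition concat_fun (x y z : X) (f : {path I from x to y})
    (g : {path I from y to z}) (t : I) : X :=
  if ival t <= 2^-1 then f (clamp (ival t * 2)) else g (clamp (ival t * 2 - 1)).

Lemma concat_continuous x y z (f : {path I from x to y})
  (g : {path I from y to z}) : continuous (concat_fun f g).
Proof.
apply: continuous_paste.
- exact: ival_continuous.
- exact/continuous_path/double_continuous/ival_continuous.
- exact/continuous_path/double_sub1_continuous/ival_continuous.
- by move=> p /half_double ->; rewrite subrr clamp_zero clamp_one path_one path_zero.
Qed.

Lemma concat_zero x y z (f : {path I from x to y}) (g : {path I from y to z}) :
  concat_fun f g zero = x.
Proof.
by rewrite /concat_fun ival_zero invr_ge0 ler0n mul0r clamp_zero path_zero.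
Qed.

Lemma concat_one x y z (f : {path I from x to y}) (g : {path I from y to z}) :
  concat_fun f g one = z.
Proof.
rewrite /concat_fun ival_one ifF; last first.
  by apply/negbTE; rewrite -ltNge invf_lt1 ?ltr1n.
by rewrite mul1r (_ : 2 - 1 = 1 :> R) ?clamp_one ?path_one //; ring.
Qed.

Definition concat x y z (f : {path I from x to y}) (g : {path I from y to z}) :
    {path I from x to z} :=
  mk_path (concat_continuous (f:=f) (g:=g)) (concat_zero f g) (concat_one f g).

Definition reverse_fun (x y : X) (f : {path I from x to y}) (t : I) : X :=
  f (clamp (1 - ival t)).

Lemma reverse_continuous x y (f : {path I from x to y}) :
  continuous (reverse_fun f).
Proof.
exact/continuous_path/compl_continuous/ival_continuous.
Qed.

Lemma reverse_zero x y (f : {path I from x to y}) : reverse_fun f zero = y.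
Proof. by rewrite /reverse_fun ival_zero subr0 clamp_one path_one. Qed.

Lemma reverse_one x y (f : {path I from x to y}) : reverse_fun f one = x.
Proof. by rewrite /reverse_fun ival_one subrr clamp_zero path_zero. Qed.

Definition reverse x y (f : {path I from x to y}) : {path I from y to x} :=
  mk_path (reverse_continuous (f:=f)) (reverse_zero f) (reverse_one f).

Definition constant_path (x : X) : {path I from x to x} := cst x.

Lemma concat_homotopic x y z (f f' : {path I from x to y})
    (g g' : {path I from y to z}) :
  path_homotopic f f' -> path_homotopic g g' ->
  path_homotopic (concat f g) (concat f' g').
Proof.
move=> [H [cH H0 H1 Hz Ho]] [K [cK K0 K1 Kz Ko]].
exists (fun p => if ival p.2 <= 2^-1 then H (p.1, clamp (ival p.2 * 2))
                 else K (p.1, clamp (ival p.2 * 2 - 1))).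
split => /= [|t|t|s|s].
- apply: continuous_paste.
  + exact: ival_snd_continuous.
  + apply: continuous_compose cH.
    apply: continuous_pair => [p|]; first exact: cvg_fst.
    exact/continuous_clamp/double_continuous/ival_snd_continuous.
  + apply: continuous_compose cK.
    apply: continuous_pair => [p|]; first exact: cvg_fst.
    exact/continuous_clamp/double_sub1_continuous/ival_snd_continuous.
  + by move=> p /half_double ->; rewrite subrr clamp_zero clamp_one Ho Kz.
- by rewrite H0 K0.
- by rewrite H1 K1.
- by rewrite ival_zero invr_ge0 ler0n mul0r clamp_zero.
- rewrite ival_one ifF; last by apply/negbTE; rewrite -ltNge invf_lt1 ?ltr1n.
  by rewrite mul1r (_ : 2 - 1 = 1 :> R) ?clamp_one //; ring.
Qed.

Lemma reverse_homotopic x y (f g : {path I from x to y}) :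
  path_homotopic f g -> path_homotopic (reverse f) (reverse g).
Proof.
move=> [H [cH H0 H1 Hz Ho]].
exists (fun p => H (p.1, clamp (1 - ival p.2))); split => /= [|t|t|s|s].
- apply: continuous_compose cH.
  apply: continuous_pair => [p|]; first exact: cvg_fst.
  exact/continuous_clamp/compl_continuous/ival_snd_continuous.
- by rewrite H0.
- by rewrite H1.
- by rewrite ival_zero subr0 clamp_one.
- by rewrite ival_one subrr clamp_zero.
Qed.

Lemma reparam_homotopic x y z w (p : {path I from z to w})
    (f g : {path I from x to y}) (phi psi : R -> R) :
  continuous phi -> continuous psi ->
  phi 0 = psi 0 -> phi 1 = psi 1 ->
  (forall t, f t = p (clamp (phi (ival t)))) ->
  (forall t, g t = p (clamp (psi (ival t)))) ->
  path_homotopic f g.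
Proof.
move=> cphi cpsi e0 e1 fE gE.
exists (fun q => p (clamp ((1 - ival q.1) * phi (ival q.2) +
                            ival q.1 * psi (ival q.2)))).
split => /= [|t|t|s|s].
- apply: continuous_path => q; apply: cvgD; apply: cvgM.
  + exact: compl_continuous ival_fst_continuous _.
  + exact: (continuous_compose ival_snd_continuous cphi).
  + exact: ival_fst_continuous.
  + exact: (continuous_compose ival_snd_continuous cpsi).
- by rewrite ival_zero fE; congr (p (clamp _)); ring.
- by rewrite ival_one gE; congr (p (clamp _)); ring.
- rewrite ival_zero -e0 -mulrDl subrK mul1r.
  by have := fE zero; rewrite path_zero ival_zero.
- rewrite ival_one -e1 -mulrDl subrK mul1r.
  by have := fE one; rewrite path_one ival_one.
Qed.

Lemma concatE x y z (f : {path I from x to y}) (g : {path I from y to z})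
    (r : R) : 0 <= r <= 1 ->
  concat f g (clamp r) =
    if r <= 2^-1 then f (clamp (r * 2)) else g (clamp (r * 2 - 1)).
Proof. by move=> r01; rewrite -[LHS]/(concat_fun f g (clamp r)) /concat_fun clampK. Qed.

Lemma reverseE x y (f : {path I from x to y}) (r : R) : 0 <= r <= 1 ->
  reverse f (clamp r) = f (clamp (1 - r)).
Proof. by move=> r01; rewrite -[LHS]/(reverse_fun f (clamp r)) /reverse_fun clampK. Qed.

Lemma concat_assoc x y z w (f : {path I from x to y}) (g : {path I from y to z})
    (h : {path I from z to w}) :
  path_homotopic (concat f (concat g h)) (concat (concat f g) h).
Proof.
apply: path_homotopic_sym.
apply: (@reparam_homotopic _ _ _ _ (concat f (concat g h)) _ _
  (fun t => Num.min (t * 2) (Num.min (t + 4^-1) (t * 2^-1 + 2^-1))) id).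
- apply: continuous_minr.
    by move=> t; apply: cvgM; [exact: cvg_id | exact: cvg_cst].
  apply: continuous_minr => t; apply: cvgD; try exact: cvg_cst.
    exact: cvg_id.
  by apply: cvgM; [exact: cvg_id | exact: cvg_cst].
- by move=> t; exact: cvg_id.
- by rewrite min_l ?le_min; lra.
- rewrite [X in Num.min _ X]min_r; last lra.
  by rewrite min_r; lra.
- move=> t; rewrite -{1}(ivalK t).
  have := ival_ge0 t; have := ival_le1 t; move: (ival t) => r r1 r0.
  rewrite concatE; last by apply/andP.
  have [r2|r2] := leP r 2^-1.
    rewrite concatE; last by apply/andP; lra.
    have [r4|r4] := leP (r * 2) 2^-1.
      rewrite min_l; last by rewrite le_min; apply/andP; lra.
      rewrite concatE; last by apply/andP; lra.
      by rewrite r4.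
    rewrite [X in Num.min _ X]min_l; last lra.
    rewrite min_r; last lra.
    rewrite concatE; last by apply/andP; lra.
    rewrite ifF; last by apply/negbTE; rewrite -ltNge; lra.
    rewrite concatE; last by apply/andP; lra.
    rewrite ifT; last lra.
    by congr (g (clamp _)); lra.
  rewrite [X in Num.min _ X]min_r; last lra.
  rewrite min_r; last lra.
  rewrite concatE; last by apply/andP; lra.
  rewrite ifF; last by apply/negbTE; rewrite -ltNge; lra.
  rewrite concatE; last by apply/andP; lra.
  rewrite ifF; last by apply/negbTE; rewrite -ltNge; lra.
  by congr (h (clamp _)); lra.
- by move=> t; rewrite ivalK.
Qed.

Lemma concat_constl x y (f : {path I from x to y}) :
  path_homotopic (concat (constant_path x) f) f.
Proof.
apply: (@reparam_homotopic _ _ _ _ f _ _ (fun t => Num.max 0 (t * 2 - 1)) id).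
- apply: continuous_maxr => t; first exact: cvg_cst.
  apply: cvgB; last exact: cvg_cst.
  by apply: cvgM; [exact: cvg_id | exact: cvg_cst].
- by move=> t; exact: cvg_id.
- by rewrite max_l //; lra.
- by rewrite max_r; lra.
- move=> t; rewrite -{1}(ivalK t).
  have := ival_ge0 t; have := ival_le1 t; move: (ival t) => r r1 r0.
  rewrite concatE; last by apply/andP.
  have [r2|r2] := leP r 2^-1.
    by rewrite max_l ?clamp_zero ?path_zero //; lra.
  by rewrite max_r //; lra.
- by move=> t; rewrite ivalK.
Qed.

Lemma concat_constr x y (f : {path I from x to y}) :
  path_homotopic (concat f (constant_path y)) f.
Proof.
apply: (@reparam_homotopic _ _ _ _ f _ _ (fun t => Num.min (t * 2) 1) id).
- apply: continuous_minr => t; last exact: cvg_cst.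
  by apply: cvgM; [exact: cvg_id | exact: cvg_cst].
- by move=> t; exact: cvg_id.
- by rewrite min_l //; lra.
- by rewrite min_r; lra.
- move=> t; rewrite -{1}(ivalK t).
  have := ival_ge0 t; have := ival_le1 t; move: (ival t) => r r1 r0.
  rewrite concatE; last by apply/andP.
  have [r2|r2] := leP r 2^-1.
    by rewrite min_l //; lra.
  by rewrite min_r ?clamp_one ?path_one //; lra.
- by move=> t; rewrite ivalK.
Qed.

Lemma concat_reverser x y (f : {path I from x to y}) :
  path_homotopic (concat f (reverse f)) (constant_path x).
Proof.
apply: (@reparam_homotopic _ _ _ _ f _ _
  (fun t => Num.min (t * 2) (2 - t * 2)) (fun=> 0)).
- apply: continuous_minr => t; last apply: cvgB; try exact: cvg_cst;
    by apply: cvgM; [exact: cvg_id | exact: cvg_cst].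
- by move=> t; exact: cvg_cst.
- by rewrite min_l; lra.
- by rewrite min_r; lra.
- move=> t; rewrite -{1}(ivalK t).
  have := ival_ge0 t; have := ival_le1 t; move: (ival t) => r r1 r0.
  rewrite concatE; last by apply/andP.
  have [r2|r2] := leP r 2^-1.
    by rewrite min_l //; lra.
  rewrite reverseE; last by apply/andP; lra.
  by rewrite min_r; [congr (f (clamp _)) | ]; lra.
- by move=> t; rewrite clamp_zero path_zero.
Qed.

Lemma concat_reversel x y (f : {path I from x to y}) :
  path_homotopic (concat (reverse f) f) (constant_path y).
Proof.
apply: (@reparam_homotopic _ _ _ _ f _ _
  (fun t => Num.max (1 - t * 2) (t * 2 - 1)) (fun=> 1)).
- apply: continuous_maxr => t; apply: cvgB; try exact: cvg_cst;
    by apply: cvgM; [exact: cvg_id | exact: cvg_cst].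
- by move=> t; exact: cvg_cst.
- by rewrite max_l; lra.
- by rewrite max_r; lra.
- move=> t; rewrite -{1}(ivalK t).
  have := ival_ge0 t; have := ival_le1 t; move: (ival t) => r r1 r0.
  rewrite concatE; last by apply/andP.
  have [r2|r2] := leP r 2^-1.
    rewrite reverseE; last by apply/andP; lra.
    by rewrite max_l //; lra.
  by rewrite max_r //; lra.
- by move=> t; rewrite clamp_one path_one.
Qed.

Variable x0 : X.

Definition loop_equiv : rel {path I from x0 to x0} :=
  fun f g => `[< path_homotopic f g >].

Lemma loop_equiv_refl : reflexive loop_equiv.
Proof. by move=> f; apply/asboolP; exact: path_homotopic_refl. Qed.

Lemma loop_equiv_sym : symmetric loop_equiv.
Proof.
by move=> f g; apply/asboolP/asboolP; exact: path_homotopic_sym.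
Qed.

Lemma loop_equiv_trans : transitive loop_equiv.
Proof.
by move=> g f h /asboolP fg /asboolP gh; apply/asboolP; exact: path_homotopic_trans gh.
Qed.

Canonical loop_equiv_rel :=
  EquivRel loop_equiv loop_equiv_refl loop_equiv_sym loop_equiv_trans.

Definition fundamental_group : Type := {eq_quot loop_equiv_rel}.

HB.instance Definition _ := Choice.on fundamental_group.

Definition loop_class (f : {path I from x0 to x0}) : fundamental_group :=
  \pi_({eq_quot loop_equiv_rel}) f.

Lemma loop_classP (f g : {path I from x0 to x0}) :
  loop_class f = loop_class g <-> path_homotopic f g.
Proof.
split=> [/eqmodP/asboolP //|fg]; apply/eqmodP; exact/asboolP.
Qed.

Definition loop_repr (a : fundamental_group) : {path I from x0 to x0} :=
  repr (a : {eq_quot loop_equiv_rel}).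

Lemma loop_reprK : cancel loop_repr loop_class.
Proof. exact: reprK. Qed.

Lemma loop_repr_class (f : {path I from x0 to x0}) :
  path_homotopic (loop_repr (loop_class f)) f.
Proof. by apply/loop_classP; rewrite loop_reprK. Qed.

Definition pi1_one : fundamental_group := loop_class (constant_path x0).

Definition pi1_mul (a b : fundamental_group) : fundamental_group :=
  loop_class (concat (loop_repr a) (loop_repr b)).

Definition pi1_inv (a : fundamental_group) : fundamental_group :=
  loop_class (reverse (loop_repr a)).

Lemma pi1_mulE (f g : {path I from x0 to x0}) :
  pi1_mul (loop_class f) (loop_class g) = loop_class (concat f g).
Proof. by apply/loop_classP/concat_homotopic; exact: loop_repr_class. Qed.

Lemma pi1_invE (f : {path I from x0 to x0}) :
  pi1_inv (loop_class f) = loop_class (reverse f).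
Proof. by apply/loop_classP/reverse_homotopic; exact: loop_repr_class. Qed.

Lemma pi1_mulA : associative pi1_mul.
Proof.
move=> a b c; rewrite -(loop_reprK a) -(loop_reprK b) -(loop_reprK c).
by rewrite !pi1_mulE; apply/loop_classP; exact: concat_assoc.
Qed.

Lemma pi1_mul1g : left_id pi1_one pi1_mul.
Proof.
move=> a; rewrite -(loop_reprK a) pi1_mulE.
by apply/loop_classP; exact: concat_constl.
Qed.

Lemma pi1_mulg1 : right_id pi1_one pi1_mul.
Proof.
move=> a; rewrite -(loop_reprK a) pi1_mulE.
by apply/loop_classP; exact: concat_constr.
Qed.

Lemma pi1_mulVg : left_inverse pi1_one pi1_inv pi1_mul.
Proof.
move=> a; rewrite -(loop_reprK a) pi1_invE pi1_mulE.
by apply/loop_classP; exact: concat_reversel.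
Qed.

Lemma pi1_mulgV : right_inverse pi1_one pi1_inv pi1_mul.
Proof.
move=> a; rewrite -(loop_reprK a) pi1_invE pi1_mulE.
by apply/loop_classP; exact: concat_reverser.
Qed.

HB.instance Definition _ := isGroup.Build fundamental_group
  pi1_mulA pi1_mul1g pi1_mulg1 pi1_mulVg pi1_mulgV.

End fundamental_group.
Arguments fundamental_group R {X} x0.

Section knots.
Context {R : realType}.

(* The norm `|x| of the library on row vectors is the sup norm, so the round
   sphere is written with the Euclidean square norm. *)
Definition sqnorm (n : nat) (x : 'rV[R]_n) : R := \sum_(i < n) x 0 i ^+ 2.

(* Used as a type through the coercion from sets, with the induced topology:
   [sphere 3 : Type] is the 3-sphere. *)
Definition sphere (n : nat) : set 'rV[R]_n.+1 := [set x | sqnorm x = 1].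
Arguments sphere n : clear implicits.

Definition homeomorphism (X Y : topologicalType) (h : X -> Y) : Prop :=
  continuous h /\ exists k : Y -> X, [/\ continuous k, cancel h k & cancel k h].

Definition knot (K : set (sphere 3)) : Prop :=
  exists h : sphere 1 -> K, homeomorphism h.

Definition stereographic_vec (x : 'rV[R]_3) : 'rV[R]_4 :=
  (sqnorm x + 1)^-1 *: row_mx (2 *: x) (const_mx (sqnorm x - 1) : 'rV[R]_1).

Lemma sqnorm_ge0 n (x : 'rV[R]_n) : 0 <= sqnorm x.
Proof. by apply: sumr_ge0 => i _; exact: sqr_ge0. Qed.

Lemma sqnormZ n (c : R) (x : 'rV[R]_n) : sqnorm (c *: x) = c ^+ 2 * sqnorm x.
Proof.
by rewrite /sqnorm mulr_sumr; apply: eq_bigr => i _; rewrite mxE exprMn.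
Qed.

Lemma sqnorm_row_mx m n (x : 'rV[R]_m) (y : 'rV[R]_n) :
  sqnorm (row_mx x y) = sqnorm x + sqnorm y.
Proof.
rewrite /sqnorm big_split_ord /=.
by congr (_ + _); apply: eq_bigr => i _; rewrite (row_mxEl, row_mxEr).
Qed.

Lemma stereographic_subproof (x : 'rV[R]_3) :
  stereographic_vec x \in sphere 3.
Proof.
apply/mem_set; rewrite /sphere /= /stereographic_vec.
rewrite (sqnormZ (n := 3 + 1)) (sqnorm_row_mx (m := 3) (n := 1)) sqnormZ.
have -> : sqnorm (const_mx (sqnorm x - 1) : 'rV[R]_1) = (sqnorm x - 1) ^+ 2.
  by rewrite /sqnorm big_ord1 mxE.
have := sqnorm_ge0 x; move: (sqnorm x) => r r0.
have r1 : r + 1 != 0 by rewrite gt_eqF // ltr_wpDl.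
by field.
Qed.

(* Inverse of the stereographic projection from the pole (0, 0, 0, 1):
   it identifies R^3 with the 3-sphere minus that pole. *)
Definition stereographic (x : 'rV[R]_3) : sphere 3 :=
  exist (fun y => y \in sphere 3) _ (stereographic_subproof x).

(* [ordS] is the cyclic successor, so the last edge closes the polygon. *)
Definition polygon_point (n : nat) (p : 'I_n -> 'rV[R]_3) (i : 'I_n) (t : R) :
    'rV[R]_3 :=
  (1 - t) *: p i + t *: p (ordS i).

Definition closed_polygon (n : nat) (p : 'I_n -> 'rV[R]_3) : set 'rV[R]_3 :=
  [set x | exists (i : 'I_n) (t : R), 0 <= t <= 1 /\ x = polygon_point p i t].

(* No self-intersection: the parametrization of the closed polygon by the
   half-open edges is injective. *)
Definition simple_polygon (n : nat) (p : 'I_n -> 'rV[R]_3) : Prop :=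
  forall (i j : 'I_n) (s t : R), 0 <= s < 1 -> 0 <= t < 1 ->
    polygon_point p i s = polygon_point p j t -> i = j /\ s = t.

Definition polygonal_knot (P : set 'rV[R]_3) : Prop :=
  exists (n : nat) (p : 'I_n -> 'rV[R]_3),
    [/\ (3 <= n)%N, simple_polygon p & P = closed_polygon p].

(* Equivalence of knots is by homeomorphisms of the 3-sphere, not required to
   preserve orientation. Since the mirror image of a polygonal knot is polygonal,
   the orientation does not affect tameness. *)
Definition tame_knot (K : set (sphere 3)) : Prop :=
  knot K /\
  exists (P : set 'rV[R]_3) (h : sphere 3 -> sphere 3),
    [/\ polygonal_knot P, homeomorphism h & h @` K = stereographic @` P].

(* [x] is the base point in the complement of [K]. *)
Definition knot_group (K : set (sphere 3)) (x : ~` K) : groupType :=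
  fundamental_group R x.

End knots.
Arguments sphere R n : clear implicits.

(* Main.v *)
(* A nonabelian group G has the nontrivial brace g o h = h g.  If G is abelian and
   s : G -> {1, -1} is a homomorphism, then g o h = g h^(s g) is a brace,
   nontrivial as soon as some g0 has s g0 = -1 and g0^2 <> 1.  Such an s is the
   parity of the linking number with the knot, and g0 is a meridian.

   The linking number is the winding number of an explicit nonvanishing complex
   function on the complement of the polygon with vertices P_k.  To v in R^3
   associate the rank-one matrix A(v) = |v| + v.sigma (sigma: Pauli matrices).
   Then F(x) = tr (A(P_0 - x) ... A(P_n - x)), whose argument is half the solid
   angle of the polygon seen from x, vanishes exactly on the polygon: with
   A(P_k - x) = c_k r_k, it is the product of the r_k c_(k+1), and
   (r_k c_(k+1)) (r_(k+1) c_k) = 2 (|v||w| + v.w) for v = P_k - x, w = P_(k+1) - x,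
   which vanishes only when x lies on the edge.  Normalizing by the norms of the
   P_k - x extends F to the point at infinity of the 3-sphere.

   To get a meridian through an arbitrary base point a, walk from a along a segment
   that meets no vertex, up to its first hit with the polygon, and circle the edge
   that was hit; there F is, up to a nearly constant factor, the trace of three
   spin matrices, which runs through an ellipse around 0. *)

Require Import Defs.
From HB Require Import structures.
From mathcomp Require Import all_boot all_order all_algebra.
From mathcomp Require Import all_classical all_reals all_analysis.
From mathcomp Require Import complex wedge_sigT continuous_path ring lra.

Set Implicit Arguments.
Unset Strict Implicit.
Unset Printing Implicit Defensive.

Import Order.TTheory GRing.Theory Num.Theory.
Import numFieldNormedType.Exports.

Local Open Scope classical_set_scope.
Local Open Scope ring_scope.
Local Open Scope complex_scope.

(** * Winding of complex-valued functions *)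

(** That a knot with abelian group is unknotted rests on Dehn's lemma, so the abelian case is not
    reduced to the unknot: the parity is built in the same way for every tame knot. Of the homology
    of the complement only two facts are kept: the rotation of [F] along loops is a homomorphism to
    the multiples of [2 pi], and some loop has rotation exactly [2 pi]. Such a loop is odd, and its
    square is not 1 because it has rotation [4 pi].

    Gauss's linking integral would ask for differentiable loops, while elements of the fundamental
    group are merely continuous; the argument of a continuous nonvanishing function lifts along any
    path. A solid angle changes by [4 pi] around a meridian, so half of it makes one turn.

    The base point is given and the complement is not shown to be connected, hence a meridian is
    built from each base point. At infinity the directions of the vertices have no limit, but they
    merge, and this alone makes the normalized trace converge, to [2 ^+ n.+1]. *)

Section complex_limits.
Context {R : realType}.
Implicit Types (z w : R[i]) (a b : R).

Lemma cReM z w : complex.Re (z * w) = complex.Re z * complex.Re w - complex.Im z * complex.Im w.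
Proof. by case: z; case: w. Qed.

Lemma cImM z w : complex.Im (z * w) = complex.Re z * complex.Im w + complex.Im z * complex.Re w.
Proof. by case: z; case: w. Qed.

Lemma cReD z w : complex.Re (z + w) = complex.Re z + complex.Re w.
Proof. by case: z; case: w. Qed.

Lemma cImD z w : complex.Im (z + w) = complex.Im z + complex.Im w.
Proof. by case: z; case: w. Qed.

Lemma complex_ext z w :
  complex.Re z = complex.Re w -> complex.Im z = complex.Im w -> z = w.
Proof. by case: z => a b; case: w => c d /= -> ->. Qed.

(** Componentwise, so that limits of complex expressions reduce to limits of real polynomials and
    square roots. *)
Definition ccvg (T : Type) (F : set_system T) (f : T -> R[i]) (l : R[i]) :=
  (complex.Re (f t) @[t --> F] --> complex.Re l) /\
  (complex.Im (f t) @[t --> F] --> complex.Im l).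

Definition ccontinuous (T : topologicalType) (f : T -> R[i]) :=
  forall t, ccvg (nbhs t) f (f t).

Section filter.
Context {T : Type} {F : set_system T} {FF : Filter F}.
Implicit Types f g : T -> R[i].

Lemma ccvg_cst l : ccvg F (fun=> l) l.
Proof. by split; exact: cvg_cst. Qed.

Lemma ccvgD f g l m : ccvg F f l -> ccvg F g m -> ccvg F (fun t => f t + g t) (l + m).
Proof.
move=> [fr fi] [gr gi]; split; rewrite (cReD, cImD).
  by under eq_fun do rewrite cReD; exact: cvgD.
by under eq_fun do rewrite cImD; exact: cvgD.
Qed.

Lemma ccvgM f g l m : ccvg F f l -> ccvg F g m -> ccvg F (fun t => f t * g t) (l * m).
Proof.
move=> [fr fi] [gr gi]; split; rewrite (cReM, cImM).
  by under eq_fun do rewrite cReM; apply: cvgB; exact: cvgM.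
by under eq_fun do rewrite cImM; apply: cvgD; exact: cvgM.
Qed.

End filter.

Lemma ccontinuous_comp (T U : topologicalType) (f : T -> U) (g : U -> R[i]) :
  continuous f -> ccontinuous g -> ccontinuous (fun t => g (f t)).
Proof.
by move=> cf cg t; have [gr gi] := cg (f t); split;
  [exact: (cvg_comp _ _ (cf t) gr) | exact: (cvg_comp _ _ (cf t) gi)].
Qed.

Lemma ccontinuousM (T : topologicalType) (f g : T -> R[i]) :
  ccontinuous f -> ccontinuous g -> ccontinuous (fun t => f t * g t).
Proof. by move=> cf cg t; exact: ccvgM. Qed.

End complex_limits.

Section polar.
Context {R : realType}.
Implicit Types (z w : R[i]) (a b : R).

Definition expi (a : R) : R[i] := cos a +i* sin a.

Lemma expiD a b : expi (a + b) = expi a * expi b.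
Proof.
apply: complex_ext; first by rewrite cReM /= cosD.
by rewrite cImM /= sinD addrC [cos a * _]mulrC; ring.
Qed.

Lemma expi0 : expi 0 = 1.
Proof. by rewrite /expi cos0 sin0. Qed.

(** A relation rather than a function: [a] is one of the arguments of [z], which cannot be 0. Lifts
    choose among the arguments continuously. *)
Definition polar z a := exists2 r : R, 0 < r & z = r%:C * expi a.

Lemma polarM z w a b : polar z a -> polar w b -> polar (z * w) (a + b).
Proof.
move=> [r r0 ->] [s s0 ->]; exists (r * s); first exact: mulr_gt0.
by rewrite expiD rmorphM /=; ring.
Qed.

Lemma polar_pos (r : R) : 0 < r -> polar r%:C 0.
Proof. by move=> r0; exists r => //; rewrite expi0 mulr1. Qed.

Lemma polar_neq0 z a : polar z a -> z != 0.
Proof.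
move=> [r r0 ->]; apply: mulf_neq0; first by rewrite fmorph_eq0 gt_eqF.
apply/eqP => -[c0 s0]; have := cos2Dsin2 a; rewrite c0 s0 !expr0n addr0.
by move/eqP; rewrite eq_sym oner_eq0.
Qed.

(** Congruence modulo [2 pi] is expressed throughout by a cosine equal to 1, which spares any
    handling of integers. *)
Lemma polar_inj z a b : polar z a -> polar z b -> cos (a - b) = 1.
Proof.
move=> [r r0 ->] [s s0] E.
have [E1 E2] : r * cos a = s * cos b /\ r * sin a = s * sin b.
  have := congr1 (@complex.Im R) E; have := congr1 (@complex.Re R) E.
  by rewrite !cReM !cImM /= !mul0r !subr0 !addr0.
have ca := cos2Dsin2 a; have cb := cos2Dsin2 b.
have rs : r = s.
  apply/eqP; rewrite -(eqrXn2 (n := 2)) ?ltW //; apply/eqP.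
  rewrite -[LHS]mulr1 -[RHS]mulr1 -{1}ca -cb !mulrDr -!exprMn E1 E2 //.
move: E1 E2; rewrite rs.
move=> /(mulfI (lt0r_neq0 s0)) E1 /(mulfI (lt0r_neq0 s0)) E2.
by rewrite cosD cosN sinN E1 E2 mulrN opprK -!expr2 cb.
Qed.

Definition slit z := ~ (complex.Im z = 0 /\ complex.Re z <= 0).

(* The half-angle form of the principal argument: one formula is continuous on
   the whole slit plane. *)
Definition half_carg z : R :=
  atan (complex.Im z / (complex.Re z + Num.sqrt (complex.Re z ^+ 2 + complex.Im z ^+ 2))).

Definition carg z : R := half_carg z + half_carg z.

Lemma slit_gt0 z : slit z ->
  0 < complex.Re z + Num.sqrt (complex.Re z ^+ 2 + complex.Im z ^+ 2).
Proof.
case: z => a b; rewrite /slit /= => sl.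
have sq : 0 <= a ^+ 2 + b ^+ 2 by rewrite addr_ge0 ?sqr_ge0.
have [a0|a0] := ltP 0 a; first by rewrite ltr_pwDl // sqrtr_ge0.
have b0 : b != 0 by apply/eqP => b0; apply: sl.
rewrite -[a in a + _]opprK addrC subr_gt0 -(ler0_norm a0) -sqrtr_sqr ltr_sqrt.
  by rewrite ltrDl exprn_even_gt0.
by rewrite ltr_wpDl ?sqr_ge0 // exprn_even_gt0.
Qed.

(** With [r] the modulus and [t] the tangent of half the argument,
    [cos (atan t) ^+ 2 = (a + r) / (2 * r)]; the double-angle formulas give back [a / r] and
    [b / r]. *)
Lemma polar_carg z : slit z -> polar z (carg z).
Proof.
move=> sl; have := slit_gt0 sl; rewrite /carg -mulr2n /half_carg.
case: z sl => a b /= sl; set r := Num.sqrt _ => ar0.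
have r2 : r ^+ 2 = a ^+ 2 + b ^+ 2 by rewrite sqr_sqrtr // addr_ge0 ?sqr_ge0.
have r0 : 0 < r.
  rewrite lt_def sqrtr_ge0 andbT; apply/eqP => r0; move: r2 ar0.
  rewrite r0 expr0n /= => /esym/eqP.
  rewrite paddr_eq0 ?sqr_ge0 // !sqrf_eq0 => /andP[/eqP -> _].
  by rewrite addr0 ltxx.
exists r => //; set t := b / (a + r).
have [ar r0'] : a + r != 0 /\ r != 0 by rewrite !gt_eqF.
have t2 : 1 + t ^+ 2 = 2 * r / (a + r).
  have -> : 2 * r / (a + r) = (2 * r * (a + r)) / (a + r) ^+ 2 by field.
  have -> : 2 * r * (a + r) = (a + r) ^+ 2 + b ^+ 2.
    have -> : b ^+ 2 = r ^+ 2 - a ^+ 2 by rewrite r2; ring.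
    by ring.
  by rewrite /t; field.
have c2 : cos (atan t) ^+ 2 = (a + r) / (2 * r).
  rewrite cos_atan exprVn sqr_sqrtr; last by rewrite addr_ge0 ?sqr_ge0.
  by rewrite t2; field; rewrite ar r0'.
have sc : sin (atan t) = t * cos (atan t).
  rewrite -[t in t * _]atanK /tan mulfVK //.
  by rewrite gt_eqF // cos_gt0_pihalf // atan_gtNpi2 atan_ltpi2.
apply: complex_ext; rewrite !(cReM, cImM) /= mul0r ?subr0 ?addr0.
  by rewrite cos_mulr2n c2 mulr2n; field.
by rewrite sin_mulr2n sc mulrCA -expr2 c2 /t mulr2n; field; rewrite ar r0'.
Qed.

Lemma carg_continuous (T : topologicalType) (f : T -> R[i]) :
  ccontinuous f -> (forall t, slit (f t)) -> continuous (fun t => carg (f t)).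
Proof.
move=> cf sl t; have [cr ci] := cf t.
suff h : half_carg (f x) @[x --> t] --> half_carg (f t) by exact: cvgD.
apply: continuous_cvg; first exact: continuous_atan.
apply: cvgM => //; apply: cvgV; first by rewrite gt_eqF // slit_gt0.
apply: cvgD => //; apply: continuous_cvg; first exact: sqrt_continuous.
by apply: cvgD; rewrite expr2; under eq_fun do rewrite expr2; exact: cvgM.
Qed.

Lemma polar_exists z : z != 0 -> exists a, polar z a.
Proof.
move=> z0; have [s|/contrapT [i0 r0]] := pselect (slit z).
  by exists (carg z); exact: polar_carg.
exists pi; exists (- complex.Re z).
  rewrite oppr_gt0 lt_def r0 andbT eq_sym; apply: contra_neq z0 => E.
  exact: complex_ext.
by apply: complex_ext; rewrite (cReM, cImM) /= cospi sinpi ?i0; ring.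
Qed.

End polar.

Section lifting.
Context {R : realType}.
Local Notation I := (unit_interval R).

Lemma cos_neq1 (c : R) : 0 < c <= pi -> cos c != 1.
Proof.
move=> /andP[c0 cpi]; apply/eqP; rewrite -cos0 => E.
suff E0 : c = 0 by rewrite E0 ltxx in c0.
by apply: cos_inj E; rewrite in_itv /= ?lexx ?pi_ge0 // cpi ltW.
Qed.

(** The hypothesis confines [u t - u zero] to the multiples of [2 pi], and a continuous function
    cannot leave 0 without crossing values whose cosine is not 1. *)
Lemma angle_constant (u : I -> R) :
  continuous u -> (forall t, cos (u t - u zero) = 1) -> forall t, u t = u zero.
Proof.
move=> cu u1 t; apply/eqP; rewrite -subr_eq0 -normr_eq0; case: eqP => // /eqP m0; exfalso.
set v := fun r : R => `|u (clamp r) - u zero|.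
have cv : continuous v.
  move=> r; apply: cvg_norm; apply: cvgB; last exact: cvg_cst.
  exact: (continuous_compose (@clamp_continuous R) cu).
have v0 : v 0 = 0 by rewrite /v clamp_zero subrr normr0.
have vt : v (ival t) = `|u t - u zero| by rewrite /v ivalK.
have vpos : 0 < v (ival t) by rewrite vt lt_def m0 normr_ge0.
(* Capping at [pi] keeps the intermediate value where the cosine is injective. *)
set c := Num.min (v (ival t)) pi.
have c0 : 0 < c by rewrite lt_min vpos pi_gt0.
have [r _ vr] : exists2 r, r \in `[0, ival t] & v r = c.
  apply: IVT; first exact: ival_ge0.
    exact: continuous_subspaceT.
  by rewrite v0 (min_idPl (ltW vpos)) (max_idPr (ltW vpos)) ltW //= /c ge_min lexx.
have : cos c != 1 by apply: cos_neq1; rewrite c0 ge_min lexx orbT.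
suff -> : cos c = 1 by rewrite eqxx.
by rewrite -vr /v; case: ger0P => _; rewrite ?cosN u1.
Qed.

(** Positivity near each diagonal point becomes uniform over the compact [K]. This supplies the mesh
    of the subdivision in [polar_lift]. *)
Lemma diagonal_positive (T : pseudoMetricType R) (K : set T) (g : T * T -> R) :
  compact K -> continuous g -> (forall z, 0 < g (z, z)) ->
  exists2 d : R, 0 < d & forall z w, K z -> ball z d w -> 0 < g (z, w).
Proof.
move=> cK cg gpos.
have : \forall d \near 0^'+, K `<=` [set z | forall w, ball z d w -> 0 < g (z, w)].
  move/compact_near_coveringP: cK; apply => z Kz.
  have : \forall p \near (z, z), 0 < g p by apply: (cvgr_gt _ (cg (z, z))).
  move=> [[A B] /= [/nbhs_ballP[e e0 eA] /nbhs_ballP[e' e'0 eB]] AB].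
  near=> z' d => w zw.
  have de : d <= e' / 2 by near: d; apply: nbhs_right_le; rewrite divr_gt0.
  apply: (AB (z', w)); split => /=.
    by apply: eA; near: z'; exact: nbhsx_ballx.
  apply: eB; apply: (@ball_split _ _ z').
    by near: z'; apply: nbhsx_ballx; rewrite divr_gt0.
  exact: le_ball zw.
move=> h; near (0 : R)^'+ => d; exists d => [|z w Kz]; first by near: d; exact: nbhs_right_gt.
suff hd : K `<=` [set z | forall w, ball z d w -> 0 < g (z, w)] by exact: hd.
by near: d.
Unshelve. all: by end_near. Qed.

Lemma conjc_mulr (z : R[i]) : z != 0 -> exists2 r : R, 0 < r & z^* * z = r%:C.
Proof.
move=> z0; exists (complex.Re z ^+ 2 + complex.Im z ^+ 2).
  rewrite lt_def addr_ge0 ?sqr_ge0 // andbT; apply: contra_neq z0 => /eqP.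
  rewrite paddr_eq0 ?sqr_ge0 // !sqrf_eq0 => /andP[/eqP zr /eqP zi].
  exact: complex_ext.
by apply: complex_ext; case: (z) => x y /=; ring.
Qed.

(** Since [z^* * z] is a positive real, [w] is a positive multiple of the product of [w * z^*] and
    [z], and arguments add. *)
Lemma polar_step (z w : R[i]) (a c : R) :
  polar z a -> polar (w * z^*) c -> polar w (a + c).
Proof.
move=> za wc; have [n n0 zz] := conjc_mulr (polar_neq0 za).
have := polarM (polarM wc za) (polar_pos (r := n^-1) _).
rewrite -[w * _ * z]mulrA zz -mulrA -rmorphM /= mulfV ?gt_eqF // mulr1 addr0 addrC.
by apply; rewrite invr_gt0.
Qed.

Lemma slit_Re_gt0 (z : R[i]) : 0 < complex.Re z -> slit z.
Proof. by move=> z0 [_]; rewrite leNgt z0. Qed.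

Lemma ccontinuous_conjM (T : topologicalType) (f g : T -> R[i]) :
  ccontinuous f -> ccontinuous g -> ccontinuous (fun t => f t * (g t)^*).
Proof.
move=> cf cg; apply: ccontinuousM => // t; have [gr gi] := cg t.
have Rc (z : R[i]) : complex.Re z^* = complex.Re z by case: z.
have Ic (z : R[i]) : complex.Im z^* = - complex.Im z by case: z.
have Rf : (fun x => complex.Re (g x)^*) = (fun x => complex.Re (g x)).
  by apply/funext => x; exact: Rc.
have If : (fun x => complex.Im (g x)^*) = (fun x => - complex.Im (g x)).
  by apply/funext => x; exact: Ic.
by split; rewrite ?Rf ?If ?Rc ?Ic //; exact: cvgN.
Qed.

(* The square is star-shaped: by compactness, the values of H at consecutive points
   of a fine enough subdivision of the segment from (0, 0) to p have a quotient in
   the right half-plane, and the principal arguments of these quotients add up. *)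
Lemma polar_lift (H : I * I -> R[i]) : ccontinuous H -> (forall p, H p != 0) ->
  exists2 th : I * I -> R, continuous th & forall p, polar (H p) (th p).
Proof.
move=> cH H0.
set c2 := fun q : R * R => (clamp q.1, clamp q.2).
have cc2 : continuous c2.
  apply: continuous_pair; apply: continuous_clamp => q; [exact: cvg_fst | exact: cvg_snd].
set h := fun q => H (c2 q).
have ch : ccontinuous h by exact: ccontinuous_comp.
set g := fun p : (R * R) * (R * R) => complex.Re (h p.2 * (h p.1)^*).
have cg : continuous g.
  have cc : ccontinuous (fun p : (R * R) * (R * R) => h p.2 * (h p.1)^*).
    by apply: ccontinuous_conjM; apply: ccontinuous_comp ch => p; [exact: cvg_snd | exact: cvg_fst].
  by move=> p; have [] := cc p.
have gpos z : 0 < g (z, z).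
  by have [r r0] := conjc_mulr (H0 (c2 z)); rewrite mulrC /g /= => ->.
have cK : compact ((`[0, 1]%classic : set R) `*` (`[0, 1]%classic : set R)).
  by apply: compact_setX; exact: segment_compact.
have [d d0 hd] := diagonal_positive cK cg gpos.
have [N Nd] : exists N : nat, N.+1%:R^-1 < d.
  by exists (Num.truncn d^-1); rewrite invf_plt ?posrE // truncnS_gt.
have N0 : 0 < N.+1%:R :> R by rewrite ltr0n.
pose pt (k : nat) (p : I * I) : R * R := (k%:R / N.+1%:R * ival p.1, k%:R / N.+1%:R * ival p.2).
pose step (k : nat) (p : I * I) := h (pt k.+1 p) * (h (pt k p))^*.
have cpt k : continuous (pt k).
  apply: continuous_pair => p; apply: cvgM; try exact: cvg_cst.
    exact: ival_fst_continuous.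
  exact: ival_snd_continuous.
have cstep k : ccontinuous (step k).
  by apply: ccontinuous_conjM; apply: ccontinuous_comp ch; exact: cpt.
have sstep k p : (k < N.+1)%N -> slit (step k p).
  move=> kN; apply: slit_Re_gt0; apply: (hd (pt k p) (pt k.+1 p)).
    have f01 (x : I) : (`[0, 1]%classic : set R) (k%:R / N.+1%:R * ival x).
      rewrite /= in_itv /= mulr_ge0 ?ival_ge0 ?divr_ge0 //=.
      rewrite mulr_ile1 ?divr_ge0 ?ival_ge0 ?ival_le1 //.
      by rewrite ler_pdivrMr // mul1r ler_nat ltnW.
    by split; exact: f01.
  have fd (x : I) : ball (k%:R / N.+1%:R * ival x) d (k.+1%:R / N.+1%:R * ival x).
    rewrite /ball /= -mulrBl -mulrBl -natr1 opprD addNKr mulN1r mulNr normrN.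
    rewrite ger0_norm ?mulr_ge0 ?invr_ge0 ?ival_ge0 //.
    by apply: le_lt_trans Nd; rewrite ler_piMr ?invr_ge0 ?ival_le1.
  by split; exact: fd.
(* All rays leave from the same corner, so a single choice of argument there serves every [p]. *)
have [a0 ha0] := polar_exists (H0 (c2 (0, 0))).
pose th m p := a0 + \sum_(k < m) carg (step k p).
have thP m p : (m <= N.+1)%N -> polar (h (pt m p)) (th m p).
  elim: m => [|m IH] mN.
    by rewrite /th big_ord0 addr0 /pt !mul0r.
  rewrite /th big_ord_recr /= addrA; apply: polar_step; first exact/IH/ltnW.
  exact/polar_carg/sstep.
have cth m : (m <= N.+1)%N -> continuous (th m).
  elim: m => [|m IH] mN p.
    rewrite (_ : th 0 = fun=> a0); first exact: cvg_cst.
    by apply/funext => q; rewrite /th big_ord0 addr0.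
  rewrite (_ : th m.+1 = fun q => th m q + carg (step m q)); last first.
    by apply/funext => q; rewrite /th big_ord_recr /= addrA.
  apply: cvgD; first exact/IH/ltnW.
  by apply: carg_continuous => // q; exact: sstep.
exists (th N.+1); first exact: cth.
move=> p.
have := thP N.+1 p (leqnn _).
by rewrite /h /c2 /pt /= mulfV ?gt_eqF // !mul1r !ivalK; case: p.
Qed.

End lifting.

Section rotation.
Context {R : realType}.
Local Notation I := (unit_interval R).
Implicit Types (f g : I -> R[i]) (a b : R).

Lemma continuous_addr (T : topologicalType) (u v : T -> R) :
  continuous u -> continuous v -> continuous (fun t => u t + v t).
Proof. by move=> cu cv t; apply: cvgD; [exact: cu | exact: cv]. Qed.

Lemma continuous_subr (T : topologicalType) (u v : T -> R) :
  continuous u -> continuous v -> continuous (fun t => u t - v t).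
Proof. by move=> cu cv t; apply: cvgB; [exact: cu | exact: cv]. Qed.

Lemma continuous_pairl (T U : topologicalType) (x : T) : continuous (fun y : U => (x, y)).
Proof. by move=> y; apply: cvg_pair => /=; [exact: cvg_cst | exact: cvg_id]. Qed.

Lemma continuous_pairr (T U : topologicalType) (y : U) : continuous (fun x : T => (x, y)).
Proof. by move=> x; apply: cvg_pair => /=; [exact: cvg_id | exact: cvg_cst]. Qed.

Definition rotates f a := exists th : I -> R,
  [/\ continuous th, forall t, polar (f t) (th t) & th one - th zero = a].

Lemma rotates_exists f : ccontinuous f -> (forall t, f t != 0) ->
  exists a, rotates f a.
Proof.
move=> cf f0.
(* A path is lifted as a map of the square that ignores the first coordinate. *)
have [th cth thP] := @polar_lift _ (fun p : I * I => f p.2)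
  (ccontinuous_comp (fun _ => cvg_snd) cf) (fun p => f0 p.2).
exists (th (zero, one) - th (zero, zero)), (fun t => th (zero, t)).
split => [|t|//]; last exact: thP (zero, t).
exact: continuous_compose (@continuous_pairl I I zero) cth.
Qed.

Lemma cos1_sin0 a : cos a = 1 -> sin a = 0.
Proof. by move=> ca; apply/eqP; rewrite -sqrf_eq0 sin2cos2 ca expr1n subrr. Qed.

Lemma expi_eq1 a : cos a = 1 -> expi a = 1.
Proof. by move=> ca; rewrite /expi ca cos1_sin0. Qed.

Lemma cos_addr_eq1 a b : cos a = 1 -> cos b = 1 -> cos (a + b) = 1.
Proof. by move=> ca cb; rewrite cosD ca cb (cos1_sin0 ca) mul0r mulr1 subr0. Qed.

Lemma cos_oppr_eq1 a : cos a = 1 -> cos (- a) = 1.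
Proof. by rewrite cosN. Qed.

Lemma polar_shift (z : R[i]) a c : cos c = 1 -> polar z a -> polar z (a + c).
Proof.
by move=> /expi_eq1 c1 [r r0 ->]; exists r => //; rewrite expiD c1 mulr1.
Qed.

(** At each time two lifts differ by a multiple of [2 pi], hence by a constant. *)
Lemma rotates_unique f a b : rotates f a -> rotates f b -> a = b.
Proof.
move=> [th [cth thP <-]] [th' [cth' thP' <-]].
have h t : th t - th' t = th zero - th' zero.
  apply: (@angle_constant _ (fun t => th t - th' t)) => [s|s].
    exact: (@continuous_subr _ th th').
  apply: cos_addr_eq1; first exact: polar_inj (thP s) (thP' s).
  exact/cos_oppr_eq1/(polar_inj (thP zero) (thP' zero)).
by have := h one; lra.
Qed.

(** A lift over the square is constant along the two sides where [H] is, so its increments along the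
    other two sides agree. *)
Lemma rotates_homotopy (H : I * I -> R[i]) : ccontinuous H ->
  (forall p, H p != 0) ->
  (forall s, H (s, zero) = H (zero, zero)) ->
  (forall s, H (s, one) = H (zero, one)) ->
  exists a, rotates (fun t => H (zero, t)) a /\ rotates (fun t => H (one, t)) a.
Proof.
move=> cH H0 Hz Ho; have [th cth thP] := polar_lift cH H0.
have cs (s : I) : continuous (fun t => th (s, t)).
  exact: continuous_compose (@continuous_pairl I I s) cth.
have ct (t : I) : continuous (fun s => th (s, t)).
  exact: continuous_compose (@continuous_pairr I I t) cth.
have e t s : (forall s, H (s, t) = H (zero, t)) -> th (s, t) = th (zero, t).
  move=> Ht; apply: (@angle_constant _ (fun s => th (s, t))); first exact: ct.
  move=> s'; apply: polar_inj (thP (zero, t)).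
  by rewrite -(Ht s'); exact: thP.
exists (th (zero, one) - th (zero, zero)); split.
  by exists (fun t => th (zero, t)); split=> // t; exact: thP (zero, t).
exists (fun t => th (one, t)); split=> [|t|]; [exact: cs | exact: thP (one, t)|].
by rewrite !(e _ one).
Qed.

Lemma rotates_loop f a : f zero = f one -> rotates f a -> cos a = 1.
Proof.
move=> f01 [th [_ thP <-]]; apply: polar_inj (thP one) _.
by rewrite -f01; exact: thP.
Qed.

Lemma rotatesM f g a b :
  rotates f a -> rotates g b -> rotates (fun t => f t * g t) (a + b).
Proof.
move=> [th [cth thP <-]] [th' [cth' thP' <-]].
exists (fun t => th t + th' t); split=> [|t|]; last by ring.
  exact: (@continuous_addr _ th th').
exact: polarM.
Qed.

Lemma rotates_scale f g a : (forall t, exists2 r : R, 0 < r & g t = r%:C * f t) ->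
  rotates f a -> rotates g a.
Proof.
move=> fg [th [cth thP <-]]; exists th; split=> // t.
by have [r r0 ->] := fg t; rewrite -[th t]add0r; apply: polarM => //; exact: polar_pos.
Qed.

Lemma rotates_slit f : ccontinuous f -> (forall t, slit (f t)) ->
  f zero = f one -> rotates f 0.
Proof.
move=> cf sf f01; exists (fun t => carg (f t)); split => [|t|].
- exact: carg_continuous.
- exact: polar_carg.
- by rewrite f01 subrr.
Qed.

Section paths.
Context {X : topologicalType} (F : X -> R[i]).

Lemma rotates_concat (x y z : X) (p : {path I from x to y})
    (q : {path I from y to z}) a b :
  rotates (fun t => F (p t)) a -> rotates (fun t => F (q t)) b ->
  rotates (fun t => F (concat p q t)) (a + b).
Proof.
move=> [th [cth thP <-]] [th' [cth' thP' <-]].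
(* At the junction the two lifts differ by a multiple of [2 pi]; the second is shifted by that
   amount. *)
have c1 : cos (th one - th' zero) = 1.
  apply: polar_inj (thP one) _.
  by have := thP' zero; rewrite path_zero path_one.
exists (fun t => if ival t <= 2^-1 then th (clamp (ival t * 2))
           else th' (clamp (ival t * 2 - 1)) + (th one - th' zero)); split.
- apply: continuous_paste.
  + exact: ival_continuous.
  + apply: continuous_compose cth.
    exact/continuous_clamp/double_continuous/ival_continuous.
  + apply: continuous_addr; last exact: cst_continuous.
    apply: continuous_compose cth'.
    exact/continuous_clamp/double_sub1_continuous/ival_continuous.
  + by move=> t /Defs.half_double ->; rewrite subrr clamp_zero clamp_one; ring.
- move=> t; rewrite -[concat p q t]/(concat_fun p q t) /concat_fun.
  by case: ifP => _; [exact: thP | exact: polar_shift].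
- rewrite ival_zero ival_one invr_ge0 ler0n mul0r clamp_zero ifF; last first.
    by apply/negbTE; rewrite -ltNge invf_lt1 ?ltr1n.
  by rewrite mul1r (_ : 2 - 1 = 1 :> R) ?clamp_one; ring.
Qed.

Lemma rotates_reverse (x y : X) (p : {path I from x to y}) a :
  rotates (fun t => F (p t)) a -> rotates (fun t => F (reverse p t)) (- a).
Proof.
move=> [th [cth thP <-]]; exists (fun t => th (clamp (1 - ival t))); split.
- apply: continuous_compose cth.
  exact/continuous_clamp/compl_continuous/ival_continuous.
- by move=> t; exact: thP.
- by rewrite ival_zero ival_one subrr subr0 clamp_zero clamp_one; ring.
Qed.

Lemma rotates_path_homotopic (x y : X) (p q : {path I from x to y}) a :
  ccontinuous F -> (forall v, F v != 0) -> path_homotopic p q ->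
  rotates (fun t => F (p t)) a -> rotates (fun t => F (q t)) a.
Proof.
move=> cF F0 [H [cH H0 H1 Hz Ho]] pa.
have [||||b [rp rq]] := @rotates_homotopy (fun r => F (H r)).
- exact: ccontinuous_comp.
- by move=> r; exact: F0.
- by move=> s; rewrite !Hz.
- by move=> s; rewrite !Ho.
have E0 : (fun t => F (H (zero, t))) = (fun t => F (p t)) by apply/funext => t; rewrite H0.
have E1 : (fun t => F (H (one, t))) = (fun t => F (q t)) by apply/funext => t; rewrite H1.
by rewrite E0 in rp; rewrite E1 in rq; rewrite (rotates_unique pa rp).
Qed.

End paths.
End rotation.

(** * Skew left braces from noncommutativity or from a sign *)

Section braces.

(** For the opposite multiplication the brace law reads [b * c * a = b * a * a^-1 * (c * a)]. *)
Lemma opposite_brace (G : groupType) : (exists g h : G, (g * h)%g <> (h * g)%g) ->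
  exists circ : G -> G -> G, nontrivial_skew_left_brace circ.
Proof.
move=> [g [h gh]]; exists (fun a b => (b * a)%g); split; last by move=> /(_ h g).
split; last by move=> a b c; rewrite -!mulgA mulVKg.
split; first by move=> a b c; rewrite mulgA.
exists 1%g, (fun a => a^-1)%g; split=> a.
- by rewrite mulg1.
- by rewrite mul1g.
- by rewrite mulgV.
- by rewrite mulVg.
Qed.

(** If [G] is not commutative, [opposite_brace] applies. Otherwise inversion is an automorphism that
    preserves [s], so the twisted law is associative, and [g0] composed with itself is 1 instead of
    [g0 * g0]. *)
Lemma sign_brace (G : groupType) (s : G -> bool) (g0 : G) :
  (forall g h, s (g * h)%g = s g (+) s h) -> s g0 -> (g0 * g0)%g <> 1%g ->
  exists circ : G -> G -> G, nontrivial_skew_left_brace circ.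
Proof.
move=> sM sg0 g00.
have [[g [h gh]]|ab] := pselect (exists g h : G, (g * h)%g <> (h * g)%g).
  by apply: opposite_brace; exists g, h.
have C (g h : G) : (g * h)%g = (h * g)%g.
  by apply: contrapT => gh; apply: ab; exists g, h.
have s1 : s 1%g = false by have := sM 1%g 1%g; rewrite mulg1; case: (s _).
have sV g : s g^-1%g = s g.
  by have := sM g g^-1%g; rewrite mulgV s1; case: (s g); case: (s _).
pose tw (b : bool) (h : G) := if b then h^-1%g else h.
have twM b g h : tw b (g * h)%g = (tw b g * tw b h)%g.
  by case: b => //=; rewrite invgM C.
have stw b g : s (tw b g) = s g by case: b => //=; exact: sV.
exists (fun g h => g * tw (s g) h)%g; split; last first.
  move=> /(_ g0 g0); rewrite sg0 /= mulgV => E; exact: g00.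
split.
  split.
    move=> g h k; rewrite sM stw twM mulgA; congr (_ * _)%g.
    by case: (s g); case: (s h); rewrite /= ?invgK.
  (* An element with [s g] true is its own inverse for the twisted law. *)
  exists 1%g, (fun g => if s g then g else g^-1)%g; split=> g.
  - by rewrite s1 mul1g.
  - by rewrite /tw; case: (s g); rewrite ?invg1 mulg1.
  - by case E : (s g); rewrite ?sV E /= ?mulgV ?mulVg.
  - by case: (s g); rewrite /= mulgV.
by move=> g h k; rewrite twM -!mulgA mulKg.
Qed.

End braces.

Section sign_of_rotation.
Context {R : realType} {X : topologicalType} (F : X -> R[i]) (x0 : X).
Local Notation I := (unit_interval R).
Local Notation G := (fundamental_group R x0).
Hypothesis (cF : ccontinuous F) (F0 : forall v, F v != 0).

(** The parity of the rotation [phi g] in units of [2 pi] is read off from the sign of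
    [cos (phi g / 2)], which is multiplicative because [sin (phi g / 2)] vanishes. *)
Lemma odd_rotation_brace (p : {path I from x0 to x0}) :
  rotates (fun t => F (p t)) (pi *+ 2) ->
  exists circ : G -> G -> G, nontrivial_skew_left_brace circ.
Proof.
move=> rp.
have [phi hphi] : {phi : G -> R & forall g, rotates (fun t => F (loop_repr g t)) (phi g)}.
  have ex (g : G) : exists a, rotates (fun t => F (loop_repr g t)) a.
    apply: rotates_exists => //.
    exact: (ccontinuous_comp (@cts_fun _ _ (loop_repr g))).
  by exists (fun g => sval (cid (ex g))) => g; exact: svalP (cid (ex g)).
have phiE (q : {path I from x0 to x0}) a :
    rotates (fun t => F (q t)) a -> phi (loop_class q) = a.
  move=> rq; apply: rotates_unique rq.
  exact: rotates_path_homotopic cF F0 (loop_repr_class q) (hphi _).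
have phiM (g h : G) : phi (g * h)%g = phi g + phi h.
  by apply: phiE; exact: rotates_concat.
have cphi (g : G) : cos (phi g) = 1.
  by apply: rotates_loop (hphi g); rewrite path_zero path_one.
have halfE (g : G) : phi g = (phi g / 2) *+ 2 by rewrite -mulr_natr mulfVK ?pnatr_eq0.
have hcos (g : G) : cos (phi g / 2) ^+ 2 = 1.
  have := cphi g; rewrite [in cos _](halfE g) cos_mulr2n mulr2n.
  by move: (cos _ ^+ 2) => c; lra.
have hsin (g : G) : sin (phi g / 2) = 0.
  by apply/eqP; rewrite -sqrf_eq0 sin2cos2 hcos subrr.
have N11 : (1 == -1 :> R) = false by rewrite -subr_eq0 opprK gt_eqF.
apply: (@sign_brace _ (fun g : G => cos (phi g / 2) == -1) (loop_class p)).
- move=> g h; rewrite phiM mulrDl cosD !hsin mul0r subr0.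
  have /eqP := hcos g; have /eqP := hcos h; rewrite !sqrf_eq1.
  by move=> /orP[] /eqP-> /orP[] /eqP->; rewrite ?mulr1 ?mul1r ?mulrNN ?mulr1 ?eqxx ?N11.
- by rewrite (phiE _ _ rp) (_ : _ / 2 = pi) ?cospi //; rewrite mulr2n; lra.
(* The square of the class has rotation [4 pi], the unit has rotation 0. *)
move=> E; have := phiM (loop_class p) (loop_class p); rewrite E (phiE _ _ rp).
have -> : phi 1%g = 0 by have := phiM 1%g 1%g; rewrite mulg1; lra.
by have := pi_gt0 R; lra.
Qed.

End sign_of_rotation.

(** * Spin matrices *)

Section rank_one.
Context {K : fieldType}.
Implicit Types (A B : 'M[K]_2).

Lemma mxtrace2E A : \tr A = A 0 0 + A 1 1.
Proof. by rewrite /mxtrace !big_ord_recl big_ord0 addr0; congr (_ + A _ _); exact: val_inj. Qed.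

Lemma mulmx2E m n (A : 'M[K]_(m, 2)) (B : 'M[K]_(2, n)) i j :
  (A *m B) i j = A i 0 * B 0 j + A i 1 * B 1 j.
Proof.
rewrite mxE !big_ord_recl big_ord0 addr0.
by congr (_ + A _ _ * B _ _); exact: val_inj.
Qed.

Definition rank_one A := exists (c : 'cV[K]_2) (r : 'rV[K]_2), A = c *m r.

Lemma rank_one_det0 A : A 0 0 * A 1 1 = A 0 1 * A 1 0 -> rank_one A.
Proof.
have ext B : A 0 0 = B 0 0 -> A 0 1 = B 0 1 -> A 1 0 = B 1 0 -> A 1 1 = B 1 1 -> A = B.
  move=> *; apply/matrixP => i j.
  have i01 (k : 'I_2) : k = 0 \/ k = 1.
    by case: k => [[|[|//]] ?]; [left | right]; exact: val_inj.
  by case: (i01 i) => ->; case: (i01 j) => ->.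
pose col (x y : K) : 'cV[K]_2 := \col_i (if i == 0 then x else y).
pose row (x y : K) : 'rV[K]_2 := \row_i (if i == 0 then x else y).
have crE x y z t i j : (col x y *m row z t) i j =
    (if i == 0 then x else y) * (if j == 0 then z else t).
  by rewrite mxE big_ord1 !mxE.
move=> dA; have [a0|a0] := eqVneq (A 0 0) 0; last first.
  exists (col (A 0 0) (A 1 0)), (row 1 (A 0 1 / A 0 0)).
  apply: ext; rewrite crE /= ?mulr1 //; first by rewrite mulrC mulfVK.
  by rewrite mulrCA mulrA -dA mulrC mulKf.
move: dA; rewrite a0 mul0r => /esym/eqP; rewrite mulf_eq0 => /orP[]/eqP b0.
  exists (col 0 1), (row (A 1 0) (A 1 1)).
  by apply: ext; rewrite crE /= ?mul0r ?mul1r.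
exists (col (A 0 1) (A 1 1)), (row 0 1).
by apply: ext; rewrite crE /= ?mulr0 ?mulr1.
Qed.

Section chain.
Variables (c : nat -> 'cV[K]_2) (r : nat -> 'rV[K]_2).
Let a k := c k *m r k.
Let br j k := (r j *m c k) 0 0.

Lemma mulmx_bracket m1 m2 (x : 'M[K]_(m1, 1)) (y : 'rV[K]_2) (z : 'cV[K]_2)
    (t : 'M[K]_(1, m2)) : (x *m y) *m (z *m t) = (y *m z) 0 0 *: (x *m t).
Proof.
rewrite mulmxA -[x *m y *m z]mulmxA [X in x *m X]mx11_scalar.
by rewrite mul_mx_scalar -scalemxAl.
Qed.

Lemma mxtrace_bracket (y : 'rV[K]_2) (z : 'cV[K]_2) : \tr (z *m y) = (y *m z) 0 0.
Proof. by rewrite mxtrace_mulC /mxtrace big_ord1. Qed.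

Lemma prod_rank_one m l : \prod_(m <= k < (m + l).+1) a k =
  (\prod_(m <= k < m + l) br k k.+1) *: (c m *m r (m + l)%N).
Proof.
elim: l => [|l IH]; first by rewrite addn0 big_nat1 big_geq // scale1r.
rewrite addnS big_nat_recr /=; last by rewrite leqW // leq_addr.
rewrite IH [in RHS]big_nat_recr /= ?leq_addr // -scalerA.
by rewrite -[_ * a _]/(_ *m a _) -scalemxAl /a mulmx_bracket.
Qed.

Lemma tr_prod_rank_one m l : \tr (\prod_(m <= k < (m + l).+1) a k) =
  (\prod_(m <= k < m + l) br k k.+1) * br (m + l) m.
Proof. by rewrite prod_rank_one mxtraceZ mxtrace_bracket. Qed.

Lemma tr_mul_rank_one j k : \tr (a j *m a k) = br j k * br k j.
Proof. by rewrite /a mulmx_bracket mxtraceZ mxtrace_bracket. Qed.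

Lemma tr_prod_neq0 m l : c (m + l).+1 = c m -> r (m + l).+1 = r m ->
  (forall k, \tr (a k *m a k.+1) != 0) ->
  \tr (\prod_(m <= k < (m + l).+1) a k) != 0.
Proof.
move=> cm rm h; have br0 k : br k k.+1 != 0.
  by have := h k; rewrite tr_mul_rank_one mulf_eq0 negb_or => /andP[].
rewrite tr_prod_rank_one mulf_neq0 //.
  by rewrite prodf_seq_neq0; apply/allP => k _; rewrite br0.
(* The bracket that closes the trace is, by periodicity, the one from [m + l] to its successor. *)
by have := br0 (m + l)%N; rewrite /br cm.
Qed.

(* Inserting a direction [q] splits the trace, up to a factor that is positive for
   spin matrices, into a triangle containing one chosen edge and a polygon that
   avoids this edge. *)
Lemma tr_insert (d : 'cV[K]_2) (s : 'rV[K]_2) m l : let q := d *m s in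
  \tr (q *m (a (m + l) *m a m)) * \tr (q *m \prod_(m <= k < (m + l).+1) a k) =
  \tr (\prod_(m <= k < (m + l).+1) a k) * (\tr (q *m a m) * \tr (q *m a (m + l))).
Proof.
move=> q; rewrite tr_prod_rank_one prod_rank_one /q /a.
rewrite mulmx_bracket -!scalemxAr !mulmx_bracket !mxtraceZ !mxtrace_bracket.
by rewrite /br; ring.
Qed.

(** The two sides through [q] replace the edge from [m + l] back to [m], so nothing is asked of the
    edge on which the point may lie. *)
Lemma tr_insert_neq0 (d : 'cV[K]_2) (s : 'rV[K]_2) m l : let q := d *m s in
  \tr (q *m a m) != 0 -> \tr (q *m a (m + l)) != 0 ->
  (forall k, (m <= k < m + l)%N -> \tr (a k *m a k.+1) != 0) ->
  \tr (q *m \prod_(m <= k < (m + l).+1) a k) != 0.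
Proof.
move=> q; rewrite prod_rank_one /q /a.
rewrite -!scalemxAr !mulmx_bracket !mxtraceZ !mxtrace_bracket.
rewrite !mulf_eq0 !negb_or => /andP[q1 _] /andP[_ q2] h.
rewrite q1 q2 /= ?andbT prodf_seq_neq0; apply/allP => k.
rewrite mem_index_iota => /h; rewrite implyTb mulmx_bracket mxtraceZ mxtrace_bracket.
by rewrite mulf_eq0 negb_or => /andP[].
Qed.

End chain.

End rank_one.

Section spin.
Context {R : realType}.
Implicit Types (u v w : 'rV[R]_3) (a b t : R).

Definition cx v : R := v 0 (Ordinal (isT : (0 < 3)%N)).
Definition cy v : R := v 0 (Ordinal (isT : (1 < 3)%N)).
Definition cz v : R := v 0 (Ordinal (isT : (2 < 3)%N)).

Lemma vec_ext v w : cx v = cx w -> cy v = cy w -> cz v = cz w -> v = w.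
Proof.
move=> x y z; apply/rowP => -[[|[|[|//]]] i].
- by rewrite (_ : Ordinal i = Ordinal (isT : (0 < 3)%N)) //; exact: val_inj.
- by rewrite (_ : Ordinal i = Ordinal (isT : (1 < 3)%N)) //; exact: val_inj.
- by rewrite (_ : Ordinal i = Ordinal (isT : (2 < 3)%N)) //; exact: val_inj.
Qed.

Definition mkvec (x y z : R) : 'rV[R]_3 :=
  \row_i (if i == 0%N :> nat then x else if i == 1%N :> nat then y else z).

Lemma cxE x y z : cx (mkvec x y z) = x. Proof. by rewrite /cx mxE. Qed.
Lemma cyE x y z : cy (mkvec x y z) = y. Proof. by rewrite /cy mxE. Qed.
Lemma czE x y z : cz (mkvec x y z) = z. Proof. by rewrite /cz mxE. Qed.
Lemma cxD v w : cx (v + w) = cx v + cx w. Proof. by rewrite /cx mxE. Qed.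
Lemma cyD v w : cy (v + w) = cy v + cy w. Proof. by rewrite /cy mxE. Qed.
Lemma czD v w : cz (v + w) = cz v + cz w. Proof. by rewrite /cz mxE. Qed.
Lemma cxN v : cx (- v) = - cx v. Proof. by rewrite /cx mxE. Qed.
Lemma cyN v : cy (- v) = - cy v. Proof. by rewrite /cy mxE. Qed.
Lemma czN v : cz (- v) = - cz v. Proof. by rewrite /cz mxE. Qed.
Lemma cxZ a v : cx (a *: v) = a * cx v. Proof. by rewrite /cx mxE. Qed.
Lemma cyZ a v : cy (a *: v) = a * cy v. Proof. by rewrite /cy mxE. Qed.
Lemma czZ a v : cz (a *: v) = a * cz v. Proof. by rewrite /cz mxE. Qed.
Lemma cx0 : cx 0 = 0. Proof. by rewrite /cx mxE. Qed.
Lemma cy0 : cy 0 = 0. Proof. by rewrite /cy mxE. Qed.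
Lemma cz0 : cz 0 = 0. Proof. by rewrite /cz mxE. Qed.

Definition coordE := (cxE, cyE, czE, cxD, cyD, czD, cxN, cyN, czN, cxZ, cyZ, czZ,
  cx0, cy0, cz0).

Definition dot v w := cx v * cx w + cy v * cy w + cz v * cz w.

Definition cross v w := mkvec (cy v * cz w - cz v * cy w)
  (cz v * cx w - cx v * cz w) (cx v * cy w - cy v * cx w).

Definition nrm v := Num.sqrt (dot v v).

Lemma sqnorm_dot v : sqnorm v = dot v v.
Proof.
rewrite /sqnorm !big_ord_recl big_ord0 addr0 addrA !expr2 /dot /cx /cy /cz.
by congr (_ * _ + _ * _ + _ * _); congr (v _ _); exact: val_inj.
Qed.

Lemma dot_ge0 v : 0 <= dot v v.
Proof. by rewrite -sqnorm_dot sqnorm_ge0. Qed.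

Lemma dot_eq0 v : dot v v = 0 -> v = 0.
Proof.
rewrite /dot -!expr2 => /eqP; rewrite !paddr_eq0 ?addr_ge0 ?sqr_ge0 // !sqrf_eq0.
by move=> /andP[/andP[/eqP x /eqP y] /eqP z]; apply: vec_ext; rewrite !coordE.
Qed.

Lemma nrm_ge0 v : 0 <= nrm v. Proof. exact: sqrtr_ge0. Qed.

Lemma nrm2 v : nrm v ^+ 2 = dot v v. Proof. by rewrite sqr_sqrtr // dot_ge0. Qed.

Lemma nrm_eq0 v : nrm v = 0 -> v = 0.
Proof. by move=> v0; apply: dot_eq0; rewrite -nrm2 v0 expr0n. Qed.

Lemma nrm_gt0 v : v != 0 -> 0 < nrm v.
Proof. by move=> v0; rewrite lt_def nrm_ge0 andbT; apply: contra_neq v0; exact: nrm_eq0. Qed.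

Lemma nrm0 : nrm 0 = 0.
Proof. by rewrite /nrm /dot !coordE !mul0r !addr0 sqrtr0. Qed.

Lemma dotZZ a v : dot (a *: v) (a *: v) = a ^+ 2 * dot v v.
Proof. by rewrite /dot !coordE; ring. Qed.

Lemma nrmZ a v : 0 <= a -> nrm (a *: v) = a * nrm v.
Proof.
by move=> a0; rewrite /nrm dotZZ sqrtrM ?sqr_ge0 // sqrtr_sqr ger0_norm.
Qed.

Lemma nrmZabs (a : R) v : nrm (a *: v) = `|a| * nrm v.
Proof. by rewrite /nrm dotZZ sqrtrM ?sqr_ge0 // sqrtr_sqr. Qed.

Lemma coord_le v j : `|v 0 j| <= nrm v.
Proof.
rewrite -sqrtr_sqr ler_sqrt ?dot_ge0 // -sqnorm_dot /sqnorm (bigD1 j) //= lerDl.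
by apply: sumr_ge0 => i _; exact: sqr_ge0.
Qed.

Lemma nrmN v : nrm (- v) = nrm v.
Proof. by rewrite /nrm /dot !coordE !mulrNN. Qed.

(** By Lagrange's identity the defect is the squared length of the cross product. *)
Lemma cauchy_schwarz v w : `|dot v w| <= nrm v * nrm w.
Proof.
rewrite -sqrtr_sqr -sqrtrM ?dot_ge0 // ler_sqrt ?mulr_ge0 ?dot_ge0 //.
rewrite -subr_ge0.
have -> : dot v v * dot w w - dot v w ^+ 2 = dot (cross v w) (cross v w).
  by rewrite /cross /dot !coordE; ring.
exact: dot_ge0.
Qed.

Lemma nrmD v w : nrm (v + w) <= nrm v + nrm w.
Proof.
rewrite -(@ler_pXn2r _ 2) ?nnegrE ?addr_ge0 ?nrm_ge0 // sqrrD !nrm2.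
have -> : dot (v + w) (v + w) = dot v v + dot v w *+ 2 + dot w w.
  by rewrite mulr2n /dot !coordE; ring.
rewrite lerD2r lerD2l lerMn2r /=.
exact: le_trans (ler_norm _) (cauchy_schwarz v w).
Qed.

(* The rank-one Hermitian matrix |v| + v.sigma, with sigma the Pauli matrices *)
Definition spin v : 'M[R[i]]_2 := \matrix_(i, j)
  if i == 0 then (if j == 0 then (nrm v + cz v) +i* 0 else cx v +i* (- cy v))
  else (if j == 0 then cx v +i* cy v else (nrm v - cz v) +i* 0).

Lemma spin00 v : spin v 0 0 = (nrm v + cz v) +i* 0. Proof. by rewrite mxE. Qed.
Lemma spin01 v : spin v 0 1 = cx v +i* (- cy v). Proof. by rewrite mxE. Qed.
Lemma spin10 v : spin v 1 0 = cx v +i* cy v. Proof. by rewrite mxE. Qed.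
Lemma spin11 v : spin v 1 1 = (nrm v - cz v) +i* 0. Proof. by rewrite mxE. Qed.

Lemma spin_rank_one v : rank_one (spin v).
Proof.
apply: rank_one_det0; rewrite spin00 spin01 spin10 spin11.
apply: complex_ext => /=; last by ring.
transitivity (nrm v ^+ 2 - cz v ^+ 2); first by ring.
by rewrite nrm2 /dot; ring.
Qed.

Lemma tr_spin2 v w : \tr (spin v *m spin w) = (2 * (nrm v * nrm w + dot v w))%:C.
Proof.
rewrite mxtrace2E !mulmx2E !spin00 !spin01 !spin10 !spin11 /dot.
by apply: complex_ext => /=; ring.
Qed.

(** Imaginary over real part is the classical formula for the tangent of half the solid angle of the
    triangle [u], [v], [w] seen from the origin. *)
Lemma tr_spin3 u v w : \tr (spin u *m (spin v *m spin w)) =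
  (2 * (nrm u * nrm v * nrm w + nrm u * dot v w + nrm v * dot u w + nrm w * dot u v))
  +i* (2 * dot u (cross v w)).
Proof.
rewrite mxtrace2E !mulmx2E !spin00 !spin01 !spin10 !spin11 /cross /dot !coordE.
by apply: complex_ext => /=; ring.
Qed.

Lemma spinZ a v : 0 <= a -> spin (a *: v) = a%:C *: spin v.
Proof.
move=> a0; apply/matrixP => i j; rewrite !mxE nrmZ // !coordE.
by case: (i == 0); case: (j == 0); apply: complex_ext => /=; ring.
Qed.

(** Cayley-Hamilton for a matrix of determinant 0 and trace [2 * nrm v]. *)
Lemma spin_sqr v : spin v *m spin v = (2 * nrm v)%:C *: spin v.
Proof.
have h := nrm2 v; rewrite /dot in h.
apply/matrixP => i j; rewrite mulmx2E !mxE.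
have : (cx v) ^+ 2 = nrm v ^+ 2 - cy v ^+ 2 - cz v ^+ 2 by rewrite h; ring.
rewrite expr2 => h'.
case: (i == 0); case: (j == 0); apply: complex_ext => /=; ring: h'.
Qed.

(** This is the case of equality in Cauchy-Schwarz for opposite directions. *)
Lemma segment_through0 v w : nrm v * nrm w + dot v w = 0 ->
  exists2 t, 0 <= t <= 1 & (1 - t) *: v + t *: w = 0.
Proof.
move=> h; have v0 := nrm_ge0 v; have w0 := nrm_ge0 w.
have [s0|s0] := eqVneq (nrm v + nrm w) 0.
  have [E F] : nrm v = 0 /\ nrm w = 0 by lra.
  exists 0; first by rewrite lexx ler01.
  by rewrite (nrm_eq0 E) scaler0 scale0r addr0.
have sp : 0 < nrm v + nrm w by rewrite lt_def s0 addr_ge0.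
(* Each vector is weighted by the length of the other; the squared length of the combination is then
   a multiple of [nrm v * nrm w + dot v w]. *)
exists (nrm v / (nrm v + nrm w)).
  by rewrite divr_ge0 ?addr_ge0 //= ler_pdivrMr // mul1r lerDl.
have -> : 1 - nrm v / (nrm v + nrm w) = nrm w / (nrm v + nrm w) by field.
apply: dot_eq0.
have -> : dot (nrm w / (nrm v + nrm w) *: v + nrm v / (nrm v + nrm w) *: w)
    (nrm w / (nrm v + nrm w) *: v + nrm v / (nrm v + nrm w) *: w) =
  (nrm w ^+ 2 * dot v v + nrm v ^+ 2 * dot w w + 2 * nrm v * nrm w * dot v w) /
    (nrm v + nrm w) ^+ 2.
  by rewrite /dot !coordE; field.
rewrite -!nrm2.
have -> : nrm w ^+ 2 * nrm v ^+ 2 + nrm v ^+ 2 * nrm w ^+ 2 + 2 * nrm v * nrm w * dot v w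
  = 2 * nrm v * nrm w * (nrm v * nrm w + dot v w) by ring.
by rewrite h mulr0 mul0r.
Qed.

Lemma dotV_ge0 v w : 0 <= nrm v * nrm w + dot v w.
Proof. by have := cauchy_schwarz v w; rewrite ler_norml; lra. Qed.

End spin.

Section spin_limits.
Context {R : realType} {T : Type} {F : set_system T} {FF : Filter F}.
Implicit Types (v w : T -> 'rV[R]_3) (M N : T -> 'M[R[i]]_2).

Definition vcvg (v : T -> 'rV[R]_3) (l : 'rV[R]_3) :=
  [/\ cx (v t) @[t --> F] --> cx l, cy (v t) @[t --> F] --> cy l &
      cz (v t) @[t --> F] --> cz l].

Definition mcvg (M : T -> 'M[R[i]]_2) (L : 'M[R[i]]_2) :=
  forall i j, ccvg F (fun t => M t i j) (L i j).

Lemma vcvg_dot v w a b : vcvg v a -> vcvg w b -> dot (v t) (w t) @[t --> F] --> dot a b.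
Proof.
by move=> [vx vy vz] [wx wy wz]; apply: cvgD; first apply: cvgD; exact: cvgM.
Qed.

Lemma vcvg_nrm v a : vcvg v a -> nrm (v t) @[t --> F] --> nrm a.
Proof.
move=> va; rewrite /nrm; apply: continuous_cvg; first exact: sqrt_continuous.
exact: vcvg_dot.
Qed.

Lemma vcvgZ (c : T -> R) v (d : R) a : c @ F --> d -> vcvg v a ->
  vcvg (fun t => c t *: v t) (d *: a).
Proof.
move=> cd [vx vy vz]; split; rewrite coordE; under eq_fun do rewrite coordE;
  exact: cvgM.
Qed.

Lemma vcvgB v w a b : vcvg v a -> vcvg w b -> vcvg (fun t => v t - w t) (a - b).
Proof.
move=> [vx vy vz] [wx wy wz]; split; rewrite !coordE;
  under eq_fun do rewrite !coordE; exact: cvgB.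
Qed.

Lemma vcvg_cst a : vcvg (fun=> a) a.
Proof. by split; exact: cvg_cst. Qed.

Lemma mcvg_spin_coords v a (n : R) : nrm (v t) @[t --> F] --> n ->
  vcvg v a -> mcvg (fun t => spin (v t)) (\matrix_(i, j)
    if i == 0 then (if j == 0 then (n + cz a) +i* 0 else cx a +i* (- cy a))
    else (if j == 0 then cx a +i* cy a else (n - cz a) +i* 0)).
Proof.
move=> vn [vx vy vz] i j; split; rewrite mxE; under eq_fun do rewrite mxE;
  case: (i == 0); case: (j == 0) => //=; try exact: cvg_cst.
- exact: cvgD.
- exact: cvgB.
- exact: cvgN.
Qed.

Lemma mcvg_spin v a : vcvg v a -> mcvg (fun t => spin (v t)) (spin a).
Proof. by move=> va; apply: mcvg_spin_coords => //; exact: vcvg_nrm. Qed.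

Lemma mcvgM M N L K : mcvg M L -> mcvg N K -> mcvg (fun t => M t *m N t) (L *m K).
Proof.
move=> ML NK i j; rewrite mulmx2E.
rewrite (_ : (fun t => _) = fun t => M t i 0 * N t 0 j + M t i 1 * N t 1 j).
  by apply: ccvgD; exact: ccvgM.
by apply/funext => t; rewrite mulmx2E.
Qed.

Lemma mcvg_cst L : mcvg (fun=> L) L.
Proof. by move=> i j; exact: ccvg_cst. Qed.

Lemma mcvg_prod (M : nat -> T -> 'M[R[i]]_2) (L : nat -> 'M[R[i]]_2) m n :
  (forall k, mcvg (M k) (L k)) ->
  mcvg (fun t => \prod_(m <= k < n) M k t) (\prod_(m <= k < n) L k).
Proof.
move=> h; rewrite /index_iota; elim: (iota _ _) => [|k s IH].
  rewrite big_nil (_ : (fun t => _) = fun=> 1); first exact: mcvg_cst.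
  by apply/funext => t; rewrite big_nil.
rewrite big_cons (_ : (fun t => _) = fun t => M k t *m \prod_(j <- s) M j t).
  exact: mcvgM.
by apply/funext => t; rewrite big_cons.
Qed.

Lemma mcvg_tr M L : mcvg M L -> ccvg F (fun t => \tr (M t)) (\tr L).
Proof.
move=> ML; rewrite mxtrace2E (_ : (fun t => _) = fun t => M t 0 0 + M t 1 1).
  by apply: ccvgD; exact: ML.
by apply/funext => t; rewrite mxtrace2E.
Qed.

Section vanishing.

Lemma cvg0_bounded (f g : T -> R) (B : R) : f @ F --> (0 : R) ->
  (\forall t \near F, `|g t| <= B) -> f t * g t @[t --> F] --> (0 : R).
Proof.
move=> f0 gB.
have fB : B * `|f t| @[t --> F] --> (0 : R).
  rewrite -[X in _ --> X](mulr0 B) -[X in _ * X](@normr0 R R).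
  by apply: cvgM; [exact: cvg_cst | exact: cvg_norm].
have fBN : - (B * `|f t|) @[t --> F] --> (0 : R) by rewrite -[X in _ --> X]oppr0; exact: cvgN.
apply: (squeeze_cvgr _ fBN fB).
near=> t; rewrite -ler_norml normrM mulrC ler_wpM2r //.
by near: t.
Unshelve. all: by end_near. Qed.

(** Meant for the point at infinity, where the direction matrices have no limit: they stay bounded,
    and only their differences converge. *)
Definition mbounded M := exists B : R, \forall t \near F, forall i j,
  `|complex.Re (M t i j)| <= B /\ `|complex.Im (M t i j)| <= B.

Lemma ccvg0 (f : T -> R[i]) : complex.Re (f t) @[t --> F] --> (0 : R) ->
  complex.Im (f t) @[t --> F] --> (0 : R) -> ccvg F f 0.
Proof. by []. Qed.

Lemma ccvg0_bounded (f g : T -> R[i]) (B : R) : ccvg F f 0 ->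
  (\forall t \near F, `|complex.Re (g t)| <= B /\ `|complex.Im (g t)| <= B) ->
  ccvg F (fun t => f t * g t) 0.
Proof.
move=> [fr fi] gB.
have gr : \forall t \near F, `|complex.Re (g t)| <= B by apply: filterS gB => t [].
have gi : \forall t \near F, `|complex.Im (g t)| <= B by apply: filterS gB => t [].
split.
  rewrite (_ : (fun t => _) = fun t =>
    complex.Re (f t) * complex.Re (g t) - complex.Im (f t) * complex.Im (g t)); last first.
    by apply/funext => t; rewrite cReM.
  have -> : complex.Re (0 : R[i]) = 0 - 0 :> R by rewrite subr0.
  by apply: cvgB; apply: cvg0_bounded => //; eassumption.
rewrite (_ : (fun t => _) = fun t =>
  complex.Re (f t) * complex.Im (g t) + complex.Im (f t) * complex.Re (g t)); last first.
  by apply/funext => t; rewrite cImM.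
have -> : complex.Im (0 : R[i]) = 0 + 0 :> R by rewrite addr0.
by apply: cvgD; apply: cvg0_bounded => //; eassumption.
Qed.

Lemma mcvg0_mull M N : mcvg M 0 -> mbounded N -> mcvg (fun t => M t *m N t) 0.
Proof.
move=> M0 [B NB] i j.
rewrite mxE (_ : (fun t => _) = fun t => M t i 0 * N t 0 j + M t i 1 * N t 1 j).
  rewrite -[X in ccvg _ _ X](addr0 (0 : R[i])).
  have M0' k : ccvg F (fun t => M t i k) 0 by have := M0 i k; rewrite mxE.
  by apply: ccvgD; apply: (ccvg0_bounded (B := B)) => //; apply: filterS NB.
by apply/funext => t; rewrite mulmx2E.
Qed.

Lemma mcvg0_mulr M N : mcvg M 0 -> mbounded N -> mcvg (fun t => N t *m M t) 0.
Proof.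
move=> M0 [B NB] i j.
rewrite mxE (_ : (fun t => _) = fun t => M t 0 j * N t i 0 + M t 1 j * N t i 1).
  rewrite -[X in ccvg _ _ X](addr0 (0 : R[i])).
  have M0' k : ccvg F (fun t => M t k j) 0 by have := M0 k j; rewrite mxE.
  by apply: ccvgD; apply: (ccvg0_bounded (B := B)) => //; apply: filterS NB.
by apply/funext => t; rewrite mulmx2E; ring.
Qed.

Lemma mcvgD M N L K : mcvg M L -> mcvg N K -> mcvg (fun t => M t + N t) (L + K).
Proof.
move=> ML NK i j; rewrite mxE (_ : (fun t => _) = fun t => M t i j + N t i j).
  exact: ccvgD.
by apply/funext => t; rewrite mxE.
Qed.

Lemma mcvgZ (c : R[i]) M L : mcvg M L -> mcvg (fun t => c *: M t) (c *: L).
Proof.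
move=> ML i j; rewrite mxE (_ : (fun t => _) = fun t => c * M t i j).
  by apply: ccvgM => //; exact: ccvg_cst.
by apply/funext => t; rewrite mxE.
Qed.

Lemma mbounded_spin v : (\forall t \near F, nrm (v t) = 1) -> mbounded (fun t => spin (v t)).
Proof.
move=> v1; exists 2; apply: filterS v1 => t v1 i j.
have := coord_le (v t); rewrite mxE v1 => vle.
have := (vle (Ordinal (isT : (0 < 3)%N))); have := (vle (Ordinal (isT : (1 < 3)%N))).
have := (vle (Ordinal (isT : (2 < 3)%N))); rewrite -/(cx _) -/(cy _) -/(cz _).
rewrite !ler_norml => /andP[z z'] /andP[y y'] /andP[x x'].
by case: (i == 0); case: (j == 0); rewrite /=; split; apply/andP; lra.
Qed.

Lemma cvg_ccvg_near (f g : T -> R[i]) l : (\forall t \near F, f t = g t) ->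
  ccvg F f l -> ccvg F g l.
Proof.
move=> fg [fr fi]; split.
  by apply: cvg_trans fr; apply: near_eq_cvg; apply: filterS fg => t ->.
by apply: cvg_trans fi; apply: near_eq_cvg; apply: filterS fg => t ->.
Qed.

(* When all the directions come together, the product of the rank-one matrices
   behaves like a power of a single one. *)
Lemma spin_prod_collapse (u : nat -> T -> 'rV[R]_3) n :
  (forall k, \forall t \near F, nrm (u k t) = 1) ->
  (forall k, vcvg (fun t => u k t - u 0%N t) 0) ->
  ccvg F (fun t => \tr (\prod_(0 <= k < n.+1) spin (u k t))) (2 ^+ n.+1).
Proof.
move=> u1 uu.
have two : (2 : R[i]) = 2%:C by rewrite (rmorph_nat (real_complex R) 2).
have bu k : mbounded (fun t => spin (u k t)) by exact: mbounded_spin.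
have du k : mcvg (fun t => spin (u k t) - spin (u 0%N t)) 0.
  have n1 l : nrm (u l t) @[t --> F] --> (1 : R).
    by apply: cvg_near_cst; apply: filterS (u1 l).
  have n0 : nrm (u k t) - nrm (u 0%N t) @[t --> F] --> (0 : R).
    by rewrite -[X in _ --> X](subrr 1); exact: cvgB.
  have [x0 y0 z0] := uu k; rewrite !coordE in x0 y0 z0.
  have spE t : spin (u k t) - spin (u 0%N t) = \matrix_(i, j)
    let d := u k t - u 0%N t in let n := nrm (u k t) - nrm (u 0%N t) in
    if i == 0 then (if j == 0 then (n + cz d) +i* 0 else cx d +i* (- cy d))
    else (if j == 0 then cx d +i* cy d else (n - cz d) +i* 0).
    apply/matrixP => i j; rewrite !mxE /= !coordE.
    by case: (i == 0); case: (j == 0); apply: complex_ext => /=; ring.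
  move=> i j; rewrite mxE; apply: ccvg0; under eq_fun do rewrite spE mxE /=;
    case: (i == 0); case: (j == 0) => //=; try exact: cvg_cst.
  - by have h := cvgD n0 z0; rewrite addr0 in h; exact: h.
  - by have h := cvgB n0 z0; rewrite subr0 in h; exact: h.
  - by have h := cvgN y0; rewrite oppr0 in h; exact: h.
(* Factors are exchanged one by one for [spin (u 0%N t)]. For a unit vector, the power [n.+1] of
   this matrix is [2 ^+ n] times itself, and its trace is 2. *)
have step : mcvg (fun t => \prod_(0 <= k < n.+1) spin (u k t) - 2 ^+ n *: spin (u 0%N t)) 0.
  elim: n => [|n IH].
    rewrite (_ : (fun t => _) = fun=> 0); first exact: mcvg_cst.
    by apply/funext => t; rewrite big_nat1 expr0 scale1r subrr.
  have := mcvgD (mcvg0_mull IH (bu n.+1)) (mcvgZ (2 ^+ n) (mcvg0_mulr (du n.+1) (bu 0%N))).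
  rewrite scaler0 addr0 => h i j; apply: cvg_ccvg_near (h i j).
  apply: filterS (u1 0%N) => t n0.
  rewrite (@big_nat_recr _ _ _ n.+1) //=.
  rewrite -[_ * spin (u n.+1 t)]/(_ *m _) mulmxBl mulmxBr spin_sqr n0 mulr1.
  rewrite scalerBr scalerA -scalemxAl subrKA exprSr two.
  reflexivity.
have := ccvgD (mcvg_tr step) (ccvg_cst (2 ^+ n.+1)).
rewrite mxtrace0 add0r => h. apply: cvg_ccvg_near (h FF FF).
apply: filterS (u1 0%N) => t n0.
rewrite linearB linearZ /= [\tr (spin _)]mxtrace2E spin00 spin11 n0.
have -> : (1 + cz (u 0%N t)) +i* 0 + (1 - cz (u 0%N t)) +i* 0 = 2%:C.
  by apply: complex_ext => /=; ring.
by rewrite exprSr two subrK.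
Qed.

End vanishing.

End spin_limits.

(** * The function on the 3-sphere *)

Section sphere_function.
Context {R : realType}.
Local Notation S := (sphere R 3).
Local Notation V := 'rV[R]_3.

(** [hd] and [ht] split R^4 along the axis of projection; on the sphere, [ht y = 1] singles out the
    pole, that is, the point at infinity. *)
Definition hd (y : S) : V := lsubmx (set_val y : 'rV[R]_(3 + 1)).
Definition ht (y : S) : R := (set_val y : 'rV[R]_(3 + 1)) 0 (rshift 3 (0 : 'I_1)).

Lemma sphere_coord_continuous (i : 'I_4) : continuous (fun y : S => (set_val y : 'rV[R]_4) 0 i).
Proof.
have cv : continuous (fun y : S => (set_val y : 'rV[R]_4)) by exact: initial_continuous.
exact: (continuous_compose cv (@coord_continuous R 1 4 0 i)).
Qed.

Lemma ht_continuous : continuous ht.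
Proof. exact: sphere_coord_continuous. Qed.

Lemma vcvg_hd (y : S) : vcvg (F := nbhs y) hd (hd y).
Proof.
split; rewrite /hd /cx /cy /cz mxE; under eq_fun do rewrite mxE;
  exact: sphere_coord_continuous.
Qed.

Lemma sphereE (y : S) : dot (hd y) (hd y) + ht y ^+ 2 = 1.
Proof.
have : sqnorm (set_val y : 'rV[R]_4) = 1 := set_valP y.
rewrite -[X in sqnorm X](@hsubmxK _ 1 3 1) (sqnorm_row_mx (m := 3) (n := 1)) sqnorm_dot.
by rewrite [sqnorm (rsubmx _)]/sqnorm big_ord1 mxE.
Qed.

Lemma sphere_ext (y z : S) : hd y = hd z -> ht y = ht z -> y = z.
Proof.
move=> h t; apply: val_inj; apply/rowP => i.
rewrite -[LHS]/((set_val y : 'rV[R]_(3 + 1)) 0 i) -[RHS]/((set_val z : 'rV[R]_(3 + 1)) 0 i).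
rewrite -(@splitK 3 1 i); case: (@fintype.split 3 1 i) => j /=.
  by have := congr1 (fun w : V => w 0 j) h; rewrite !mxE.
by rewrite (ord1 j); exact: t.
Qed.

Lemma hd_stereographic (x : V) : hd (stereographic x) = (2 / (dot x x + 1)) *: x.
Proof.
rewrite /hd -[set_val _]/(stereographic_vec x) /stereographic_vec.
rewrite -[RHS](@row_mxKl _ 1 3 1 _ ((sqnorm x + 1)^-1 *: const_mx (sqnorm x - 1))).
congr lsubmx; rewrite (@scale_row_mx _ 1 3 1) scalerA sqnorm_dot.
by rewrite [2 / _]mulrC.
Qed.

Lemma ht_stereographic (x : V) : ht (stereographic x) = (dot x x - 1) / (dot x x + 1).
Proof.
rewrite /ht -[set_val _]/(stereographic_vec x) /stereographic_vec mxE.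
by rewrite (@row_mxEr _ 1 3 1) mxE sqnorm_dot mulrC.
Qed.

Lemma dot1_neq0 (x : V) : dot x x + 1 != 0.
Proof. by rewrite gt_eqF // ltr_wpDl // dot_ge0. Qed.

Lemma ht_stereographicB (x : V) : 1 - ht (stereographic x) = 2 / (dot x x + 1).
Proof. by rewrite ht_stereographic; field; exact: dot1_neq0. Qed.

Lemma ht_stereographic_neq1 (x : V) : ht (stereographic x) != 1.
Proof.
rewrite eq_sym -subr_eq0 ht_stereographicB mulf_neq0 ?pnatr_eq0 //.
by rewrite invr_neq0 // dot1_neq0.
Qed.

Lemma stereographic_eq (y : S) (x : V) : ht y != 1 -> hd y = (1 - ht y) *: x ->
  y = stereographic x.
Proof.
move=> s1 hx; have := sphereE y; rewrite hx dotZZ => E.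
have s1' : 1 - ht y != 0 by rewrite subr_eq0 eq_sym.
have E' : (1 - ht y) * (dot x x + 1) = 2.
  apply: (mulfI s1'); apply/eqP; rewrite -subr_eq0; apply/eqP.
  transitivity ((1 - ht y) ^+ 2 * dot x x + ht y ^+ 2 - 1); first by ring.
  by rewrite E subrr.
have E2 : 1 - ht y = 2 / (dot x x + 1).
  by rewrite -E' mulfK ?dot1_neq0.
apply: sphere_ext; first by rewrite hd_stereographic -E2.
by have := ht_stereographicB x; rewrite -E2; lra.
Qed.

Lemma stereographic_surj (y : S) : ht y != 1 -> exists x, y = stereographic x.
Proof.
move=> s1; exists ((1 - ht y)^-1 *: hd y); apply: stereographic_eq => //.
by rewrite scalerA mulfV ?scale1r // subr_eq0 eq_sym.
Qed.

Lemma stereographic_inj : injective (@stereographic R).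
Proof.
move=> x z E; have Eh := congr1 hd E; have := congr1 (fun y => 1 - ht y) E.
rewrite !ht_stereographicB => Et; rewrite !hd_stereographic -Et in Eh.
apply: (scalerI _ Eh); rewrite mulf_neq0 ?pnatr_eq0 // invr_neq0 //.
exact: dot1_neq0.
Qed.

Section closed_chain.
Variables (n : nat) (P : nat -> V).
Hypothesis Pn : forall k, P (k + n.+1) = P k.

(** Vertices are indexed by all naturals with period [n.+1], so that the cyclic successor is [k.+1]
    and a product may start at any vertex. *)
Definition chain : set V :=
  [set x | exists (k : nat) (t : R), 0 <= t <= 1 /\ x = (1 - t) *: P k + t *: P k.+1].

Definition chain_spin (x : V) : R[i] := \tr (\prod_(0 <= k < n.+1) spin (P k - x)).

(** For [y = stereographic x] this is [(1 - ht y) *: (P k - x)]: the direction from [x] to the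
    vertex, in a form that is polynomial in [y]. *)
Definition view (k : nat) (y : S) : V := (1 - ht y) *: P k - hd y.

Let north : V := mkvec 0 0 1.

(* Direction from y to the k-th vertex; at the pole, where this direction has no
   limit, the value is irrelevant as long as it does not depend on k. *)
Definition sight (k : nat) (y : S) : V :=
  if ht y == 1 then north else (nrm (view k y))^-1 *: view k y.

Definition sphere_spin (y : S) : R[i] :=
  \tr (\prod_(0 <= k < n.+1) spin (sight k y)).

Lemma spin_prod_neq0 (v : nat -> V) : (forall k, v (k + n.+1) = v k) ->
  (forall k, nrm (v k) * nrm (v k.+1) + dot (v k) (v k.+1) != 0) ->
  \tr (\prod_(0 <= k < n.+1) spin (v k)) != 0.
Proof.
move=> vn v0; have vn0 : v n.+1 = v 0%N := vn 0%N.
have cr (w : V) : {x : 'cV[R[i]]_2 * 'rV[R[i]]_2 | spin w = x.1 *m x.2}.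
  by apply: cid; have [c [r E]] := spin_rank_one w; exists (c, r).
pose c k := (sval (cr (v k))).1; pose r k := (sval (cr (v k))).2.
have E k : spin (v k) = c k *m r k := svalP (cr (v k)).
under eq_bigr do rewrite E.
have := @tr_prod_neq0 _ c r 0 n; rewrite add0n; apply.
- by rewrite /c vn0.
- by rewrite /r vn0.
- move=> k; rewrite -!E tr_spin2 fmorph_eq0 mulf_neq0 ?pnatr_eq0 //.
Qed.

Lemma chain_spin_neq0 x : ~ chain x -> chain_spin x != 0.
Proof.
move=> xP; apply: spin_prod_neq0 => k; first by rewrite Pn.
apply/eqP => /segment_through0[t t01 E]; apply: xP; exists k, t; split => //.
apply/eqP; rewrite eq_sym -subr_eq0; apply/eqP; rewrite -E.
by apply: vec_ext; rewrite !coordE; ring.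
Qed.

Lemma view_segment (y : S) k t : ht y != 1 -> 0 <= t <= 1 ->
  (1 - t) *: view k y + t *: view k.+1 y = 0 -> (@stereographic R @` chain) y.
Proof.
move=> s1 t01 E; exists ((1 - t) *: P k + t *: P k.+1); first by exists k, t.
apply/esym/stereographic_eq => //; apply/eqP; rewrite eq_sym -subr_eq0; apply/eqP.
by rewrite -E /view; apply: vec_ext; rewrite !coordE; ring.
Qed.

Lemma sphere_spin_neq0 (y : S) : ~ (@stereographic R @` chain) y -> sphere_spin y != 0.
Proof.
move=> yP; apply: spin_prod_neq0 => k; first by rewrite /sight /view Pn.
rewrite /sight; case: ifPn => [_|s1].
  by rewrite -expr2 nrm2 /dot /north !coordE gt_eqF //; lra.
apply/eqP => E; apply: yP.
have [t t01 F] : exists2 t, 0 <= t <= 1 & (1 - t) *: view k y + t *: view k.+1 y = 0.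
  apply: segment_through0; move: E.
  have [->|v0] := eqVneq (view k y) 0; first by rewrite nrm0 /dot !coordE; lra.
  have [->|w0] := eqVneq (view k.+1 y) 0; first by rewrite nrm0 /dot !coordE; lra.
  have [v0' w0'] := (nrm_gt0 v0, nrm_gt0 w0).
  rewrite !nrmZ ?invr_ge0 ?nrm_ge0 // !mulVf ?gt_eqF // mulr1.
  set a := nrm _; set b := nrm _ => E.
  have := congr1 (fun z => a * b * z) E; rewrite mulr0 => <-.
  by rewrite /dot !coordE; field; rewrite !gt_eqF.
exact: view_segment F.
Qed.

(** [spin] is positively homogeneous, so normalizing the directions costs a positive factor.
    Rotations can thus be computed in R^3 with [chain_spin]. *)
Lemma sphere_spin_stereographic x : ~ chain x ->
  exists2 r : R, 0 < r & sphere_spin (stereographic x) = r%:C * chain_spin x.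
Proof.
move=> xP.
have x0 k : P k - x != 0.
  apply/eqP => E; apply: xP; exists k, 0; rewrite lexx ler01; split=> //.
  by rewrite subr0 scale1r scale0r addr0; apply/esym/eqP; rewrite -subr_eq0 E.
have sE k : sight k (stereographic x) = (nrm (P k - x))^-1 *: (P k - x).
  rewrite /sight (negbTE (ht_stereographic_neq1 x)) /view hd_stereographic.
  rewrite -ht_stereographicB -scalerBr.
  have s0 : 0 < 1 - ht (stereographic x).
    by rewrite ht_stereographicB divr_gt0 // ltr_wpDl // dot_ge0.
  rewrite nrmZ ?ltW // scalerA; congr (_ *: _).
  by field; rewrite !gt_eqF // nrm_gt0.
rewrite /sphere_spin /chain_spin.
have h m : exists2 r : R, 0 < r & \prod_(0 <= k < m) spin (sight k (stereographic x)) =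
    r%:C *: \prod_(0 <= k < m) spin (P k - x).
  elim: m => [|m [r r0 IH]].
    by exists 1 => //; rewrite !big_geq // scale1r.
  exists (r * (nrm (P m - x))^-1); first by rewrite mulr_gt0 // invr_gt0 nrm_gt0.
  rewrite !big_nat_recr //= IH sE spinZ ?invr_ge0 ?nrm_ge0 //.
  by rewrite -scalerAl -scalerAr scalerA -rmorphM.
have [r r0 ->] := h n.+1.
by exists r => //; rewrite mxtraceZ.
Qed.

Lemma view_neq0 (y : S) k : ~ (@stereographic R @` chain) y -> ht y != 1 ->
  view k y != 0.
Proof.
move=> yP s1; apply/eqP => E; apply: yP; apply: (@view_segment y k 0) => //.
  by rewrite lexx ler01.
by rewrite E scaler0 scale0r addr0.
Qed.

(** The difference splits into the displacement of the vector and the change of its length; each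
    contributes at most [nrm (v - w) / nrm w]. *)
Lemma nrm_unitB (v w : V) : v != 0 -> w != 0 ->
  nrm ((nrm v)^-1 *: v - (nrm w)^-1 *: w) <= 2 * nrm (v - w) / nrm w.
Proof.
move=> v0 w0; have [v0' w0'] := (nrm_gt0 v0, nrm_gt0 w0).
have -> : (nrm v)^-1 *: v - (nrm w)^-1 *: w =
    (nrm w)^-1 *: (v - w) + ((nrm w - nrm v) / nrm w) *: ((nrm v)^-1 *: v).
  by apply: vec_ext; rewrite !coordE; field; rewrite !gt_eqF.
apply: le_trans (nrmD _ _) _; rewrite nrmZ ?invr_ge0 ?nrm_ge0 //.
have h : `|nrm w - nrm v| <= nrm (v - w).
  rewrite ler_norml lerNl opprB; apply/andP; split; rewrite lerBlDr.
    by have := nrmD (v - w) w; rewrite subrK.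
  by have := nrmD (w - v) v; rewrite subrK -[nrm (w - v)]nrmN opprB.
rewrite nrmZabs nrmZ ?invr_ge0 ?nrm_ge0 // mulVf ?gt_eqF // mulr1 normrM normfV.
rewrite (ger0_norm (nrm_ge0 w)).
have b0 : 0 <= (nrm w)^-1 by rewrite invr_ge0 nrm_ge0.
by have := ler_wpM2r b0 h; lra.
Qed.

Lemma sphere_spin_pole (y : S) : ht y = 1 -> sphere_spin y = 2 ^+ n.+1.
Proof.
move=> y1; have nn : nrm north = 1.
  by rewrite /nrm /dot !coordE !mulr0 !add0r mulr1 sqrtr1.
have two : (2 : R[i]) = 2%:C by rewrite (rmorph_nat (real_complex R) 2).
have E m : \prod_(0 <= k < m.+1) spin (sight k y) = 2 ^+ m *: spin north.
  elim: m => [|m IH]; first by rewrite big_nat1 expr0 scale1r /sight y1 eqxx.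
  rewrite big_nat_recr //= IH /sight y1 eqxx -[_ * _]/(_ *m _) -scalemxAl spin_sqr.
  by rewrite nn mulr1 scalerA exprSr two.
rewrite /sphere_spin E mxtraceZ mxtrace2E spin00 spin11 nn exprSr.
by congr (_ * _); rewrite two; apply: complex_ext => /=; ring.
Qed.

(** Only the pole is delicate. With [s] the root of [1 - ht], the views have length at least [s / 2]
    near the pole but differ from each other by order [s ^+ 2]; so the unit directions merge at rate
    [s], and [spin_prod_collapse] applies. *)
Lemma sphere_spin_continuous (y : S) : ~ (@stereographic R @` chain) y ->
  ccvg (nbhs y) sphere_spin (sphere_spin y).
Proof.
move=> yP; have cs := @ht_continuous y.
have [y1|y1] := eqVneq (ht y) 1; last first.
  pose g z := \tr (\prod_(0 <= k < n.+1) spin ((nrm (view k z))^-1 *: view k z)).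
  have sg z : ht z != 1 -> sphere_spin z = g z.
    by move=> z1; rewrite /sphere_spin /sight (negbTE z1).
  have gy : ccvg (nbhs y) g (g y).
    apply: mcvg_tr; apply: mcvg_prod => k; apply: mcvg_spin.
    have vk : vcvg (F := nbhs y) (view k) (view k y).
      apply: vcvgB; last exact: vcvg_hd.
      by apply: vcvgZ; [exact: cvgB (cvg_cst _) cs | exact: vcvg_cst].
    apply: vcvgZ => //; apply: cvgV; last exact: vcvg_nrm.
    by rewrite gt_eqF // nrm_gt0 // view_neq0.
  rewrite sg //; apply: cvg_ccvg_near gy.
  have hc : ht z - 1 @[z --> y] --> ht y - 1 by exact: cvgB cs (cvg_cst _).
  have : \forall z \near y, ht z - 1 != 0 by apply: (cvgr_neq0 _ hc); rewrite subr_eq0.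
  by apply: filterS => z; rewrite subr_eq0 => /sg.
rewrite sphere_spin_pole //.
have d0 z : 0 <= 1 - ht z.
  have := sphereE z; have := dot_ge0 (hd z); have := sqr_ge0 (1 - ht z).
  have -> : (1 - ht z) ^+ 2 = 1 - 2 * ht z + ht z ^+ 2 by ring.
  by lra.
pose s z := Num.sqrt (1 - ht z).
have cd : 1 - ht z @[z --> y] --> (0 : R).
  by have h := cvgB (cvg_cst (1 : R)) cs; rewrite y1 subrr in h; exact: h.
have cs0 : s z @[z --> y] --> (0 : R).
  by rewrite -[X in _ --> X]sqrtr0; apply: continuous_cvg cd; exact: sqrt_continuous.
have s2 z : s z ^+ 2 = 1 - ht z by rewrite sqr_sqrtr.
have s0 z : 0 <= s z by exact: sqrtr_ge0.
(* On the sphere, [dot (hd z) (hd z)] is [1 - ht z] times [1 + ht z], and [ht z] is positive near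
   the pole. *)
have near_hd : \forall z \near y, s z <= nrm (hd z).
  have : \forall z \near y, 1 - ht z < 1 by apply: cvgr_lt cd _ _; exact: ltr01.
  apply: filterS => z z1; rewrite ler_sqrt ?dot_ge0 //.
  rewrite (_ : dot _ _ = (1 - ht z) + (1 - ht z) * ht z).
    by rewrite lerDl mulr_ge0 //; lra.
  by transitivity (1 - ht z ^+ 2); [rewrite -(sphereE z) addrK | ring].
have near_view k : \forall z \near y, s z / 2 <= nrm (view k z).
  have hk : s z * nrm (P k) @[z --> y] --> (0 : R).
    by have h := cvgM cs0 (cvg_cst (nrm (P k))); rewrite mul0r in h; exact: h.
  have : \forall z \near y, s z * nrm (P k) < 2^-1 by apply: cvgr_lt hk _ _; rewrite invr_gt0.
  apply: filterS2 near_hd => z hz kz.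
  have := nrmD ((1 - ht z) *: P k) (- view k z).
  have -> : (1 - ht z) *: P k - view k z = hd z.
    by rewrite /view; apply: vec_ext; rewrite !coordE; ring.
  rewrite nrmN nrmZ // -s2 expr2 -mulrA => h.
  have := ler_wpM2l (s0 z) (ltW kz); lra.
have spos z : ht z != 1 -> 0 < s z.
  by move=> z1; rewrite sqrtr_gt0 lt_def d0 andbT subr_eq0 eq_sym.
have nz z k : ht z != 1 -> s z / 2 <= nrm (view k z) -> view k z != 0.
  move=> /spos sz; apply: contraTneq => ->; rewrite nrm0 -ltNge divr_gt0 //.
apply: spin_prod_collapse => k.
  apply: filterS (near_view k) => z hz; rewrite /sight.
  case: ifPn => [_|z1]; first by rewrite /nrm /dot !coordE !mulr0 !add0r mulr1 sqrtr1.
  have v0 := nz _ _ z1 hz.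
  by rewrite nrmZ ?invr_ge0 ?nrm_ge0 // mulVf // gt_eqF // nrm_gt0.
(* The 4 is the factor 2 of [nrm_unitB] divided by the 1/2 in the lower bound on the views. *)
have bound : \forall z \near y,
    nrm (sight k z - sight 0%N z) <= 4 * nrm (P k - P 0%N) * s z.
  apply: filterS2 (near_view k) (near_view 0%N) => z hk h0; rewrite /sight.
  case: ifPn => [_|z1]; first by rewrite subrr nrm0 !mulr_ge0 // nrm_ge0.
  apply: le_trans (nrm_unitB (nz _ _ z1 hk) (nz _ _ z1 h0)) _.
  have -> : view k z - view 0%N z = (1 - ht z) *: (P k - P 0%N).
    by rewrite /view; apply: vec_ext; rewrite !coordE; ring.
  rewrite nrmZ // -s2 ler_pdivrMr; last by apply: lt_le_trans h0; rewrite divr_gt0 ?spos.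
  have := ler_wpM2l (mulr_ge0 (nrm_ge0 (P k - P 0%N)) (s0 z)) h0.
  by rewrite expr2; lra.
have cb : 4 * nrm (P k - P 0%N) * s z @[z --> y] --> (0 : R).
  by have h := cvgM (cvg_cst (4 * nrm (P k - P 0%N))) cs0; rewrite mulr0 in h; exact: h.
have cbN : - (4 * nrm (P k - P 0%N) * s z) @[z --> y] --> (0 : R).
  by have h := cvgN cb; rewrite oppr0 in h; exact: h.
split; rewrite coordE; apply: (squeeze_cvgr _ cbN cb); apply: filterS bound => z bz;
  rewrite -ler_norml; apply: le_trans bz; exact: coord_le.
Qed.

End closed_chain.
End sphere_function.

(** * Meridians *)

Section meridian_circle.
Context {R : realType}.
Local Notation V := 'rV[R]_3.
Implicit Types (v w d : V).

(** The product is [|v|^2] minus the square of [v.sigma], and these are equal. *)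
Lemma spin_opp v : spin (- v) *m spin v = 0.
Proof.
have h := nrm2 v; rewrite /dot in h.
have h' : cx v * cx v = nrm v ^+ 2 - cy v ^+ 2 - cz v ^+ 2 by rewrite h; ring.
apply/matrixP => i j; rewrite mulmx2E !mxE nrmN !coordE.
case: (i == 0); case: (j == 0); apply: complex_ext => /=; ring: h'.
Qed.

Lemma spin_mul_eq0 v w t : 0 <= t <= 1 -> (1 - t) *: v + t *: w = 0 ->
  spin v *m spin w = 0.
Proof.
move=> /andP[t0 t1] h.
have [z0|z0] := eqVneq t 0.
  move: h; rewrite z0 subr0 scale1r scale0r addr0 => ->.
  by have := @spinZ R 0 (0 : V) (lexx _); rewrite !scale0r => ->; rewrite mul0mx.
have tp : 0 < t by rewrite lt_def z0.
have E : w = - (((1 - t) / t) *: v).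
  have : t *: w = - ((1 - t) *: v) by apply/eqP; rewrite -subr_eq0 opprK addrC h.
  move=> /(congr1 (fun x => t^-1 *: x)); rewrite scalerA mulVf // scale1r => ->.
  by rewrite scalerN scalerA mulrC.
have st : 0 <= (1 - t) / t by rewrite divr_ge0 ?subr_ge0.
rewrite E -scalerN spinZ // -scalemxAr.
by have := spin_opp (- v); rewrite opprK => ->; rewrite scaler0.
Qed.

Section circle.
Variables (A d w : V) (la eps : R).
Hypotheses (la01 : 0 < la < 1) (eps0 : 0 < eps) (w1 : dot w w = 1) (wd : dot w d = 0)
  (d0 : d != 0).

Definition circle_normal : V := (nrm d)^-1 *: cross d w.

(** Under the section hypotheses, [w], [circle_normal] and the direction of [d] are orthonormal.
    Angle 0 lies on the side of [w], where the path from the base point will arrive. *)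
Definition circle (a : R) : V :=
  A + la *: d + eps *: (cos a *: w + sin a *: circle_normal).

(** [L1] and [L2] do not depend on [a], so the trace describes an ellipse with centre on the real
    line and axes parallel to the coordinate axes. *)
Lemma circle_spin a : let L1 := nrm (A - circle a) in let L2 := nrm (A + d - circle a) in
  [/\ L1 ^+ 2 = la ^+ 2 * nrm d ^+ 2 + eps ^+ 2,
      L2 ^+ 2 = (1 - la) ^+ 2 * nrm d ^+ 2 + eps ^+ 2 &
  \tr (spin w *m (spin (A - circle a) *m spin (A + d - circle a))) =
  (2 * (L1 * L2 + eps ^+ 2 - la * (1 - la) * nrm d ^+ 2 - eps * (L1 + L2) * cos a))
   +i* (- (2 * nrm d * eps * sin a))].
Proof.
set D := nrm d; have D2 : D ^+ 2 = dot d d := nrm2 d.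
have D0 : D != 0 by rewrite gt_eqF // nrm_gt0.
set w' := circle_normal; set r : V := cos a *: w + sin a *: w'.
have cs := cos2Dsin2 a.
have dw' : dot d w' = 0 by rewrite /w' /circle_normal /cross /dot !coordE; ring.
have ww' : dot w w' = 0 by rewrite /w' /circle_normal /cross /dot !coordE; ring.
have w'w' : dot w' w' = 1.
  have -> : dot w' w' = D^-1 ^+ 2 * (dot d d * dot w w - dot w d ^+ 2).
    by rewrite /w' /circle_normal -/D /cross /dot !coordE; ring.
  by rewrite w1 wd -D2; field.
have wdw' : dot w (cross d w') = - D.
  have -> : dot w (cross d w') = D^-1 * (dot w d ^+ 2 - dot d d * dot w w).
    by rewrite /w' /circle_normal -/D /cross /dot !coordE; ring.
  by rewrite w1 wd -D2; field.
have rr : dot r r = 1.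
  have -> : dot r r = cos a ^+ 2 * dot w w + 2 * cos a * sin a * dot w w' + sin a ^+ 2 * dot w' w'.
    by rewrite /r /dot !coordE; ring.
  by rewrite w1 ww' w'w' !mulr1 mulr0 addr0 cs.
have dr : dot d r = 0.
  have -> : dot d r = cos a * dot w d + sin a * dot d w' by rewrite /r /dot !coordE; ring.
  by rewrite wd dw'; ring.
have wr : dot w r = cos a.
  have -> : dot w r = cos a * dot w w + sin a * dot w w' by rewrite /r /dot !coordE; ring.
  by rewrite w1 ww'; ring.
have wdr : dot w (cross d r) = - (D * sin a).
  have -> : dot w (cross d r) = sin a * dot w (cross d w') by rewrite /r /cross /dot !coordE; ring.
  by rewrite wdw'; ring.
have E1 : A - circle a = (- la) *: d - eps *: r.
  by rewrite /circle -/w' -/r; apply: vec_ext; rewrite !coordE; ring.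
have E2 : A + d - circle a = (1 - la) *: d - eps *: r.
  by rewrite /circle -/w' -/r; apply: vec_ext; rewrite !coordE; ring.
have dotE (x y x' y' : R) (u v : V) : dot (x *: u - y *: v) (x' *: u - y' *: v) =
    x * x' * dot u u - (x * y' + y * x') * dot u v + y * y' * dot v v.
  by rewrite /dot !coordE; ring.
rewrite /= E1 E2; split.
- by rewrite nrm2 dotE dr rr -D2; ring.
- by rewrite nrm2 dotE dr rr -D2; ring.
rewrite tr_spin3.
have nw : nrm w = 1 by rewrite /nrm w1 sqrtr1.
have wE (x : R) : dot w (x *: d - eps *: r) = - (eps * cos a).
  transitivity (x * dot w d - eps * dot w r); first by rewrite /dot !coordE; ring.
  by rewrite wd wr; ring.
have crE : dot w (cross ((- la) *: d - eps *: r) ((1 - la) *: d - eps *: r)) =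
    eps * dot w (cross d r) by rewrite /cross /dot !coordE; ring.
rewrite nw !wE dotE dr rr -D2 crE wdr.
by apply: complex_ext => /=; ring.
Qed.

(** If the trace lay on the closed ray of argument [a], imaginary parts would force [sin a = 0]; but
    the ellipse is at a negative real point when [cos a = 1] and at a positive one when
    [cos a = -1]. So the trace turns along with [- expi a]. *)
Lemma slit_circle a :
  slit (- expi (- a) * \tr (spin w *m (spin (A - circle a) *m spin (A + d - circle a)))).
Proof.
have [] := circle_spin a; have := nrm_ge0 (A - circle a).
have := nrm_ge0 (A + d - circle a); have := nrm_gt0 d0; rewrite /=.
move: (nrm (A - circle a)) (nrm (A + d - circle a)) (nrm d) (\tr _).
move=> L1 L2 D z D0 L20 L10 h1 h2 zE [i0 r0].
have [la0 la1] : 0 < la /\ la < 1 by apply/andP.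
have cs := cos2Dsin2 a.
pose q := - expi (- a) * z; rewrite -/q in i0 r0.
have zq : z = - expi a * q.
  have ee : expi a * expi (- a) = 1 by rewrite -expiD subrr expi0.
  by rewrite /q mulrA mulrNN ee mul1r.
have [rz iz] : complex.Re z = - complex.Re q * cos a /\ complex.Im z = - complex.Re q * sin a.
  by rewrite zq mulNr; case: (q) i0 => x y /= ->; split; ring.
rewrite zE /= in rz iz.
have le0 : 0 < 2 * D * eps by rewrite !mulr_gt0.
have s0 : sin a = 0.
  have : sin a * (2 * D * eps - complex.Re q) = 0.
    transitivity (- complex.Re q * sin a - - (2 * D * eps * sin a)); first by ring.
    by rewrite -iz subrr.
  by move/eqP; rewrite mulf_eq0 => /orP[/eqP //|/eqP]; lra.
have muD : 0 < (1 - la) * D by rewrite mulr_gt0 // subr_gt0.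
have laD : 0 < la * D by rewrite mulr_gt0.
(* [L] is the hypotenuse over the legs [x] and [eps]: at least each leg, less than their sum. *)
have ub x L : 0 < x -> 0 <= L -> L ^+ 2 = x ^+ 2 + eps ^+ 2 -> eps <= L /\ L - eps < x /\ x <= L.
  move=> x0 L0 LE; have x2 : 0 < x ^+ 2 by rewrite exprn_gt0.
  have e2 : 0 < eps ^+ 2 by rewrite exprn_gt0.
  have le2 (p r : R) : 0 <= p -> 0 <= r -> p ^+ 2 <= r ^+ 2 -> p <= r.
    by move=> p0 r0'; rewrite ler_pXn2r // nnegrE.
  split; first by apply: le2 => //; rewrite ?LE ?lerDr ltW.
  split; last by apply: le2 => //; rewrite ?LE ?lerDl ltW.
  rewrite ltNge; apply/negP => h; have : (x + eps) ^+ 2 <= L ^+ 2.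
    by rewrite ler_pXn2r ?nnegrE ?addr_ge0 ?(ltW x0) ?(ltW eps0) // -lerBrDr.
  by rewrite LE sqrrD addrAC gerDl leNgt pmulrn_lgt0 ?mulr_gt0.
have [e1 [l1 g1]] := ub _ _ laD L10 (etrans h1 (congr2 +%R (esym (exprMn _ _ _)) erefl)).
have [e2 [l2 g2]] := ub _ _ muD L20 (etrans h2 (congr2 +%R (esym (exprMn _ _ _)) erefl)).
(* [p1] will exclude [cos a = 1], and [p2] will exclude [cos a = -1]. *)
have p1 : (L1 - eps) * (L2 - eps) < la * D * ((1 - la) * D).
  by apply: ltr_pM => //; rewrite subr_ge0.
have p2 : la * D * ((1 - la) * D) <= L1 * L2 by apply: ler_pM => //; exact: ltW.
have eps2 : 0 < eps ^+ 2 by rewrite exprn_gt0.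
have eL : 0 <= eps * (L1 + L2) by rewrite mulr_ge0 ?addr_ge0 // ltW.
have key1 : (L1 - eps) * (L2 - eps) = L1 * L2 + eps ^+ 2 - eps * (L1 + L2) by ring.
have key2 : la * D * ((1 - la) * D) = la * (1 - la) * D ^+ 2 by ring.
rewrite key1 key2 in p1; rewrite key2 in p2.
have /eqP : cos a ^+ 2 = 1 by rewrite -cs s0 expr0n addr0.
rewrite sqrf_eq1 => /orP[] /eqP c1; rewrite c1 in rz; lra.
Qed.

End circle.
End meridian_circle.

Section meridian.
Context {R : realType}.
Local Notation V := 'rV[R]_3.
Local Notation I := (unit_interval R).

Lemma vcvgD (T : Type) (F : set_system T) {FF : Filter F} (v w : T -> V) (a b : V) :
  vcvg (F := F) v a -> vcvg (F := F) w b -> vcvg (F := F) (fun t => v t + w t) (a + b).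
Proof.
move=> [vx vy vz] [wx wy wz]; split; rewrite !coordE;
  under eq_fun do rewrite !coordE; exact: cvgD.
Qed.

Definition vcontinuous (T : topologicalType) (f : T -> V) :=
  forall t, vcvg (F := nbhs t) f (f t).

Lemma vcontinuous_id : vcontinuous (fun x : V => x).
Proof. by move=> x; split; exact: coord_continuous. Qed.

Lemma vcontinuous_comp (T U : topologicalType) (f : T -> U) (g : U -> V) :
  continuous f -> vcontinuous g -> vcontinuous (fun t => g (f t)).
Proof.
by move=> cf cg t; have [gx gy gz] := cg (f t); split;
  [exact: (cvg_comp _ _ (cf t) gx) | exact: (cvg_comp _ _ (cf t) gy) |
   exact: (cvg_comp _ _ (cf t) gz)].
Qed.

Definition turn (t : I) : R := pi *+ 2 * ival t.

Lemma turn_continuous : continuous turn.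
Proof. exact: (continuous_compose ival_continuous (@mulrl_continuous R (pi *+ 2))). Qed.

Lemma turn0 : turn zero = 0.
Proof. by rewrite /turn ival_zero mulr0. Qed.

Lemma turn1 : turn one = pi *+ 2.
Proof. by rewrite /turn ival_one mulr1. Qed.

Lemma circle_continuous (A d w : V) (la eps : R) : vcontinuous (circle A d w la eps).
Proof.
move=> a; apply: vcvgD; first exact: vcvg_cst.
apply: vcvgZ; first exact: cvg_cst.
apply: vcvgD; apply: vcvgZ; try exact: vcvg_cst; first exact: continuous_cos.
exact: continuous_sin.
Qed.

Lemma circle_closed (A d w : V) (la eps : R) :
  circle A d w la eps (turn one) = circle A d w la eps (turn zero).
Proof. by rewrite /circle turn0 turn1 cos2pi sin2pi cos0 sin0. Qed.

(** Divided by [- expi a], which turns once, the trace stays in the slit plane, where the principal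
    argument returns to its start. *)
Lemma rotates_circle (A d w : V) (la eps : R) : 0 < la < 1 -> 0 < eps ->
  dot w w = 1 -> dot w d = 0 -> d != 0 ->
  rotates (fun t : I => let x := circle A d w la eps (turn t) in
    \tr (spin w *m (spin (A - x) *m spin (A + d - x)))) (pi *+ 2).
Proof.
move=> la01 eps0 w1 wd d0; set E := fun t : I => _.
have cE : ccontinuous E.
  have cEa : ccontinuous (fun a => let x := circle A d w la eps a in
      \tr (spin w *m (spin (A - x) *m spin (A + d - x)))).
    move=> a; apply: mcvg_tr; apply: mcvgM; first exact: mcvg_cst.
    by apply: mcvgM; apply: mcvg_spin; apply: vcvgB;
      [exact: vcvg_cst | exact: circle_continuous | exact: vcvg_cst | exact: circle_continuous].
  exact: (ccontinuous_comp turn_continuous cEa).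
have ce : ccontinuous (fun t : I => - expi (- turn t)).
  have cea : ccontinuous (fun a : R => - expi (- a)).
    move=> a; have ct : - b @[b --> a] --> - a by apply: cvgN; exact: cvg_id.
    by split; apply: cvgN; apply: continuous_cvg ct; 
      [exact: continuous_cos | exact: continuous_sin].
  exact: (ccontinuous_comp turn_continuous cea).
have r0 : rotates (fun t => - expi (- turn t) * E t) 0.
  apply: rotates_slit.
  - exact: ccontinuousM.
  - by move=> t; exact: slit_circle.
  - by rewrite /E circle_closed turn0 turn1 /expi !cosN !sinN cos2pi sin2pi cos0 sin0.
have r1 : rotates (fun t => - expi (turn t)) (pi *+ 2).
  exists (fun t => turn t + pi); split => [|t|].
  - by apply: continuous_addr; [exact: turn_continuous | exact: cst_continuous].
  - exists 1 => //; rewrite mul1r expiD; apply: complex_ext;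
    by rewrite (cReM, cImM) /= cospi sinpi; ring.
  - by rewrite turn0 turn1; ring.
have := rotatesM r1 r0; rewrite addr0; congr rotates; apply/funext => t.
by rewrite mulrA mulrNN -expiD subrr expi0 mul1r.
Qed.

Lemma rotates_cst (z : R[i]) : z != 0 -> rotates (fun=> z) 0.
Proof.
move=> /polar_exists[a za]; exists (fun=> a); split=> //; last by rewrite subrr.
exact: cst_continuous.
Qed.

Lemma ccontinuous_cst (T : topologicalType) (z : R[i]) : ccontinuous (fun _ : T => z).
Proof. by move=> t; exact: ccvg_cst. Qed.

(** The quotient of [f] by [z] stays in the right half-plane, so it cannot turn. *)
Lemma rotates_near_cst (f : I -> R[i]) (z : R[i]) : ccontinuous f -> f zero = f one ->
  z != 0 -> (forall t, 0 < complex.Re (f t * z^*)) -> rotates f 0.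
Proof.
move=> cf f01 z0 fz.
have h : rotates (fun t => f t * z^* * z) (0 + 0).
  apply: rotatesM; last exact: rotates_cst.
  apply: rotates_slit => [|t|]; last by rewrite f01.
    by apply: ccontinuousM => //; exact: ccontinuous_cst.
  exact: slit_Re_gt0.
rewrite addr0 in h; apply: rotates_scale h => t.
have [r r0 zz] := conjc_mulr z0; exists r^-1; first by rewrite invr_gt0.
rewrite -mulrA zz mulrCA -rmorphM /= mulVf ?gt_eqF // mulr1 //.
Qed.

Lemma circle_dir (d w : V) a : dot w w = 1 -> dot w d = 0 -> d != 0 ->
  let r := cos a *: w + sin a *: circle_normal d w in dot r r = 1.
Proof.
move=> w1 wd d0 r; have D0 : nrm d != 0 by rewrite gt_eqF // nrm_gt0.
have -> : dot r r = cos a ^+ 2 * dot w w +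
    sin a ^+ 2 * ((nrm d)^-1 ^+ 2 * (dot d d * dot w w - dot w d ^+ 2)).
  by rewrite /r /circle_normal /cross /dot !coordE; ring.
by rewrite w1 wd -nrm2 -[RHS](cos2Dsin2 a); field.
Qed.

Section chain.
Variables (n : nat) (P : nat -> V).
Hypothesis Pn : forall k, P (k + n.+1) = P k.

Lemma chain_spin_shift m x :
  \tr (\prod_(m <= k < m + n.+1) spin (P k - x)) = chain_spin n P x.
Proof.
elim: m => [|m <-]; first by rewrite add0n.
rewrite addSn big_nat_recr /=; last by rewrite -addSnnS leq_addr.
rewrite [in RHS]big_ltn; last by rewrite addnS ltnS leq_addr.
by rewrite -[_ * _]/(_ *m _) mxtrace_mulC Pn.
Qed.

(** The matrices of the two ends of the edge containing [x] are adjacent in the cyclic product and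
    multiply to 0. Together with [chain_spin_neq0], this makes the polygon a zero set. *)
Lemma chain_spin_eq0 x : (0 < n)%N -> chain P x -> chain_spin n P x = 0.
Proof.
move=> n0 [k [t [t01 ->]]]; set q := _ + _; rewrite -(chain_spin_shift k).
rewrite big_ltn; last by rewrite addnS ltnS leq_addr.
rewrite big_ltn; last by rewrite -addSnnS -[k.+1 in X in (X < _)%N]addn0 ltn_add2l.
rewrite mulrA -[_ * spin (P k.+1 - q)]/(_ *m _) (@spin_mul_eq0 _ _ _ t) //.
  by rewrite mul0r mxtrace0.
by apply: vec_ext; rewrite /q !coordE; ring.
Qed.

(** By [tr_insert], [E * G] is [chain_spin] times the nonnegative real [pr]; [E] turns once, and [G]
    stays near the nonzero value [G q]. The centre [la'] may differ from [la] because an oblique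
    approach does not arrive exactly abreast of [q]. *)
Lemma meridian (k : nat) (la : R) (w : V) (d := P k.+1 - P k) (q := P k + la *: d) :
  0 < la < 1 -> d != 0 -> dot w w = 1 -> dot w d = 0 ->
  (forall j t, (k < j <= k + n)%N -> 0 <= t <= 1 -> q <> (1 - t) *: P j + t *: P j.+1) ->
  exists2 eta : R, 0 < eta & forall la' eps : R, 0 < la' < 1 -> `|la' - la| < eta ->
    0 < eps < eta ->
    rotates (fun t : I => chain_spin n P (circle (P k) d w la' eps (turn t))) (pi *+ 2)
      /\ forall a, chain_spin n P (circle (P k) d w la' eps a) != 0.
Proof.
move=> la01 d0 w1 wd qP.
have [la0 la1] : 0 < la /\ la < 1 by apply/andP.
pose A x j := spin (P j - x).
pose G x : R[i] := \tr (spin w *m \prod_(k.+1 <= j < (k.+1 + n).+1) A x j).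
pose E x : R[i] := \tr (spin w *m (A x k *m A x k.+1)).
have nw : nrm w = 1 by rewrite /nrm w1 sqrtr1.
(* Starting the product at [k.+1] makes the edge from [P k] to [P k.+1] the closing one, which
   [tr_insert] splits off. *)
have Pkn : P (k.+1 + n)%N = P k by rewrite addSnnS Pn.
have cr (v : V) : {x : 'cV[R[i]]_2 * 'rV[R[i]]_2 | spin v = x.1 *m x.2}.
  by apply: cid; have [c [r e]] := spin_rank_one v; exists (c, r).
pose col v := (sval (cr v)).1; pose row v := (sval (cr v)).2.
have crE v : spin v = col v *m row v := svalP (cr v).
have twE (v : V) : \tr (spin w *m spin v) = (2 * (nrm v + dot w v))%:C.
  by rewrite tr_spin2 nw mul1r.
pose pr x := 2 * (nrm (P k.+1 - x) + dot w (P k.+1 - x)) *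
  (2 * (nrm (P k - x) + dot w (P k - x))).
have EG x : E x * G x = chain_spin n P x * (pr x)%:C.
  rewrite /pr.
  have := @tr_insert _ (fun j => col (P j - x)) (fun j => row (P j - x)) (col w) (row w) k.+1 n.
  rewrite /= -!crE Pkn !twE -rmorphM /= -(chain_spin_shift k.+1) addnS /E /G /A.
  by under eq_bigr do rewrite -crE.
have Gq : G q != 0.
  have := @tr_insert_neq0 _ (fun j => col (P j - q)) (fun j => row (P j - q))
    (col w) (row w) k.+1 n.
  rewrite /= -!crE Pkn !twE /G /A.
  under eq_bigr do rewrite -crE.
  apply.
  - rewrite (_ : P k.+1 - q = (1 - la) *: d); last first.
      by apply: vec_ext; rewrite /q /d !coordE; ring.
    rewrite nrmZ ?subr_ge0 ?ltW // (_ : dot w _ = (1 - la) * dot w d); last first.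
      by rewrite /dot !coordE; ring.
    by rewrite wd mulr0 addr0 fmorph_eq0 !mulf_neq0 ?pnatr_eq0 ?subr_eq0 ?gt_eqF ?nrm_gt0.
  - rewrite (_ : P k - q = - (la *: d)); last first.
      by apply: vec_ext; rewrite /q /d !coordE; ring.
    rewrite nrmN nrmZ ?ltW // (_ : dot w _ = - la * dot w d); last first.
      by rewrite /dot !coordE; ring.
    by rewrite wd mulr0 addr0 fmorph_eq0 !mulf_neq0 ?pnatr_eq0 ?gt_eqF ?nrm_gt0.
  - move=> j jk; rewrite -!crE tr_spin2 fmorph_eq0 mulf_neq0 ?pnatr_eq0 //.
    apply/eqP => /segment_through0[t t01 e]; apply: (qP j t) => //.
    apply/eqP; rewrite eq_sym -subr_eq0; apply/eqP; rewrite -e.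
    by apply: vec_ext; rewrite !coordE; ring.
have cG : ccontinuous G.
  move=> x; apply: mcvg_tr; apply: mcvgM; first exact: mcvg_cst.
  apply: mcvg_prod => j; apply: mcvg_spin; apply: vcvgB; first exact: vcvg_cst.
  exact: vcontinuous_id.
have nearG : \forall x \near q, 0 < complex.Re (G x * (G q)^*).
  have [cr0 _] := ccvgM (cG q) (ccvg_cst (G q)^*).
  apply: (cvgr_gt _ cr0); have [r r0] := conjc_mulr Gq.
  by rewrite mulrC => ->.
move/nbhs_ballP: nearG => [e e0 ball_e].
have de0 : 0 < nrm d + 1 by rewrite ltr_wpDl ?nrm_ge0.
(* A point of the circle is at distance at most [|la' - la| * nrm d + eps] from [q], which is below
   [eta * (nrm d + 1) = e]. *)
exists (e / (nrm d + 1)); first exact: divr_gt0.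
move=> la' eps la'01 lae /andP[eps0 epse].
have inball a : ball q e (circle (P k) d w la' eps a).
  split=> // i j; rewrite (ord1 i) /ball /=.
  set x := circle _ _ _ _ _ _; rewrite distrC.
  have h : nrm (x - q) < e.
    have -> : x - q = (la' - la) *: d + eps *: (cos a *: w + sin a *: circle_normal d w).
      by rewrite /x /circle /q; apply: vec_ext; rewrite !coordE; ring.
    apply: le_lt_trans (nrmD _ _) _; rewrite nrmZabs nrmZ ?ltW //.
    rewrite {2}/nrm circle_dir // sqrtr1 mulr1.
    apply: le_lt_trans (lerD (ler_wpM2r (nrm_ge0 d) (ltW lae)) (lexx _)) _.
    by rewrite -ltrBrDl (_ : e - _ = e / (nrm d + 1)) //; field; rewrite gt_eqF.
  by apply: le_lt_trans h; have := coord_le (x - q) j; rewrite !mxE.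
have dE : P k + d = P k.+1 by rewrite /d addrC subrK.
have E0 a : E (circle (P k) d w la' eps a) != 0.
  apply/eqP => Ez; have := @slit_circle _ (P k) d w la' eps la'01 eps0 w1 wd d0 a.
  by rewrite dE -/(A _ _) -[\tr _]/(E _) Ez mulr0; apply.
have G0 a : G (circle (P k) d w la' eps a) != 0.
  apply/eqP => Gz; have := ball_e _ (inball a).
  by rewrite /= Gz mul0r /= ltxx.
have EG0 a : chain_spin n P (circle (P k) d w la' eps a) *
    (pr (circle (P k) d w la' eps a))%:C != 0.
  by rewrite -EG; apply: mulf_neq0; [exact: E0 | exact: G0].
split; last by move=> a; have := EG0 a; rewrite mulf_eq0 negb_or => /andP[].
have pr0 a : 0 < pr (circle (P k) d w la' eps a).
  have := EG0 a; rewrite mulf_eq0 negb_or fmorph_eq0 => /andP[_ p0].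
  rewrite lt_def p0 /pr; set x := circle _ _ _ _ _ _.
  have := dotV_ge0 w (P k.+1 - x); have := dotV_ge0 w (P k - x); rewrite nw !mul1r => h1 h2.
  by rewrite !mulr_ge0.
have rE : rotates (fun t => E (circle (P k) d w la' eps (turn t))) (pi *+ 2).
  by have := @rotates_circle (P k) d w la' eps la'01 eps0 w1 wd d0; rewrite dE.
have rG : rotates (fun t => G (circle (P k) d w la' eps (turn t))) 0.
  apply: (rotates_near_cst (z := G q)); [| |exact: Gq|].
  - have cGa : ccontinuous (fun a => G (circle (P k) d w la' eps a)).
      move=> a; have ca := @circle_continuous (P k) d w la' eps a.
      apply: mcvg_tr; apply: mcvgM; first exact: mcvg_cst.
      by apply: mcvg_prod => j; apply: mcvg_spin; apply: vcvgB ca; exact: vcvg_cst.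
    exact: (ccontinuous_comp turn_continuous cGa).
  - by congr G; rewrite circle_closed.
  - by move=> t; exact: ball_e (inball _).
have := rotatesM rE rG; rewrite addr0; apply: rotates_scale => t.
set x := circle _ _ _ _ _ _; exists (pr x)^-1; first by rewrite invr_gt0 pr0.
by rewrite EG mulrCA -rmorphM /= mulVf ?gt_eqF ?pr0 // mulr1.
Qed.

End chain.
End meridian.

(** * Reaching the polygon from the base point *)

Section simple_chain.
Context {R : realType}.
Local Notation V := 'rV[R]_3.
Local Notation I := (unit_interval R).
Variables (n : nat) (P : nat -> V).
Hypothesis Pn : forall k, P (k + n.+1) = P k.
Hypothesis n0 : (0 < n)%N.
Hypothesis simpleP : forall i j s t, 0 <= s < 1 -> 0 <= t < 1 ->
  (1 - s) *: P i + s *: P i.+1 = (1 - t) *: P j + t *: P j.+1 -> i = j %[mod n.+1].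

Lemma periodic_mod k : P (k %% n.+1) = P k.
Proof.
rewrite {2}(divn_eq k n.+1) addnC; elim: (k %/ n.+1)%N => [|q IH].
  by rewrite mul0n addn0.
by rewrite mulSn [(n.+1 + _)%N]addnC addnA Pn.
Qed.

Lemma neq_mod k j : (k < j <= k + n)%N -> k <> j %[mod n.+1].
Proof.
move=> /andP[kj jn] /eqP; rewrite eq_sym eqn_mod_dvd; last exact: ltnW.
by move/dvdn_leq; rewrite subn_gt0 => /(_ kj); rewrite leqNgt ltnS leq_subLR jn.
Qed.

Lemma chain_vertex k : chain P (P k).
Proof.
by exists k, 0; rewrite lexx ler01 subr0 scale1r scale0r addr0.
Qed.

Lemma vertex_neq k j : (k < j <= k + n)%N -> P k <> P j.
Proof.
move=> kj E; apply: (neq_mod kj); apply: (@simpleP _ _ 0 0); rewrite ?lexx ?ltr01 //.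
by rewrite subr0 !scale1r !scale0r !addr0.
Qed.

(** By Lagrange's identity, the squared length of the component of [w] orthogonal to [v] is that of
    [cross v w] over [dot v v]. *)
Lemma cross_eq0 (v w : V) : v != 0 -> cross v w = 0 -> w = (dot v w / dot v v) *: v.
Proof.
move=> v0 c0; have vv : dot v v != 0 by apply: contra_neq v0; exact: dot_eq0.
apply/eqP; rewrite -subr_eq0; apply/eqP; apply: dot_eq0.
transitivity (dot (cross v w) (cross v w) / dot v v).
  have -> : dot (cross v w) (cross v w) = dot v v * dot w w - dot v w ^+ 2.
    by rewrite /cross /dot !coordE; ring.
  set c := dot v w / _.
  have -> : dot (w - c *: v) (w - c *: v) = dot w w - 2 * c * dot v w + c ^+ 2 * dot v v.
    by rewrite /dot !coordE; ring.
  by rewrite /c; field.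
by rewrite c0 /dot !coordE !mul0r !addr0 mul0r.
Qed.

Lemma exists_max (r : nat -> R) m : exists2 k, (k <= m)%N & forall j, (j <= m)%N -> r j <= r k.
Proof.
elim: m => [|m [k km h]]; first by exists 0%N => // j; rewrite leqn0 => /eqP ->.
have [le|lt] := leP (r m.+1) (r k).
  exists k; first exact: leqW.
  by move=> j; rewrite leq_eqVlt ltnS => /orP[/eqP -> //|/h].
exists m.+1 => // j; rewrite leq_eqVlt ltnS => /orP[/eqP -> //|/h jk].
exact: le_trans jk (ltW lt).
Qed.

(* If every edge were collinear with a, all vertices would lie on one line
   through a, and the two edges at an extremal vertex would overlap. *)
Lemma exists_edge_off_line a : ~ chain P a ->
  exists k, cross (P k - a) (P k.+1 - P k) != 0.
Proof.
move=> aP; apply: contrapT => H.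
have x0 k : P k - a != 0.
  by apply/eqP => /eqP; rewrite subr_eq0 => /eqP E; apply: aP; rewrite -E; exact: chain_vertex.
have c0 k : cross (P k - a) (P k.+1 - a) = 0.
  have : cross (P k - a) (P k.+1 - P k) = 0.
    by apply/eqP; case: eqP => // /eqP E; exfalso; apply: H; exists k.
  move=> <-; rewrite /cross; apply: vec_ext; rewrite !coordE; ring.
pose x := P 0%N - a; pose r k := dot x (P k - a) / dot x x.
have xx : dot x x != 0 by apply: contra_neq (x0 0%N); exact: dot_eq0.
have rE k : P k - a = r k *: x.
  suff [s E] : exists s, P k - a = s *: x.
    rewrite /r E; congr (_ *: _); rewrite (_ : dot x _ = s * dot x x) ?mulfK //.
    by rewrite /dot !coordE; ring.
  elim: k => [|k [s IH]]; first by exists 1; rewrite scale1r.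
  by rewrite (cross_eq0 (x0 k) (c0 k)) IH scalerA; eexists.
have PE k : P k = a + r k *: x by rewrite -rE addrC subrK.
have [k _ kmax] := exists_max r n.
have kmax' j : r j <= r k.
  by have := kmax (j %% n.+1)%N; rewrite /r periodic_mod; apply; rewrite -ltnS ltn_mod.
have strict j : P k <> P j -> 0 < r k - r j.
  move=> kj; rewrite subr_gt0 lt_def kmax' andbT; apply/eqP => E; apply: kj.
  by rewrite !PE E.
have g1 : 0 < r k - r k.+1 by apply: strict; apply: vertex_neq; rewrite ltnSn -addn1 leq_add2l.
have g2 : 0 < r k - r (k + n)%N.
  by apply: strict; apply: vertex_neq; rewrite leqnn andbT -[X in (X < _)%N]addn0 ltn_add2l.
set h1 := r k - r k.+1 in g1; set h2 := r k - r (k + n)%N in g2.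
have h12 : 0 < h1 + h2 by rewrite addr_gt0.
(* At this parameter the edges leaving and reaching the extremal vertex are both at depth
   [h1 * h2 / (h1 + h2)] below it, so they share a point. *)
have s01 : 0 <= h2 / (h1 + h2) < 1.
  by rewrite divr_ge0 ?ltW //= ltr_pdivrMr // mul1r ltrDr.
have : k = (k + n)%N %[mod n.+1].
  apply: (simpleP s01 s01); rewrite -addnS Pn !PE.
  have -> : r k.+1 = r k - h1 by rewrite /h1; ring.
  have -> : r (k + n)%N = r k - h2 by rewrite /h2; ring.
  by apply: vec_ext; rewrite !coordE; field; rewrite gt_eqF.
by apply: neq_mod; rewrite leqnn andbT -[X in (X < _)%N]addn0 ltn_add2l.
Qed.

(** Pigeonhole: there are [n.+2] candidate targets on the edge for [n.+1] vertices. Lines from [a]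
    to two different targets meet only in [a], which is not a vertex. *)
Lemma exists_generic_target a k (d := P k.+1 - P k) : ~ chain P a -> cross (P k - a) d != 0 ->
  exists2 t, 0 < t < 1 & forall j s, P j <> a + s *: (P k + t *: d - a).
Proof.
move=> aP kd; apply: contrapT => H.
have bad t : 0 < t < 1 -> exists j : 'I_n.+1, exists s, P j = a + s *: (P k + t *: d - a).
  move=> t01; apply: contrapT => B; apply: H; exists t => // j s E; apply: B.
  have jn : (j %% n.+1 < n.+1)%N by rewrite ltn_mod.
  by exists (Ordinal jn), s; rewrite /= periodic_mod.
pose tt (i : 'I_n.+2) : R := i.+1%:R / n.+3%:R.
have tt01 i : 0 < tt i < 1.
  by rewrite /tt divr_gt0 ?ltr0n //= ltr_pdivrMr ?ltr0n // mul1r ltr_nat ltnS ltn_ord.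
pose f i : 'I_n.+1 := sval (cid (bad _ (tt01 i))).
have fP i : exists s, P (f i) = a + s *: (P k + tt i *: d - a) := svalP (cid (bad _ (tt01 i))).
have : ~ injective f.
  by move=> /leq_card; rewrite !card_ord ltnn.
apply; move=> i j fij; apply: contrapT => ij.
have [s1 E1] := fP i; have [s2] := fP j; rewrite -fij E1 => /addrI E2.
have tij : tt i != tt j.
  apply/eqP => /(mulIf _); rewrite invr_neq0 ?pnatr_eq0 // => /(_ isT) /eqP.
  by rewrite eqr_nat eqSS => /eqP/val_inj.
set x := P k - a in kd.
have E3 (s t : R) : s *: (P k + t *: d - a) = s *: x + (s * t) *: d.
  by apply: vec_ext; rewrite /x !coordE; ring.
rewrite !E3 in E2.
(* Cross products with [d] and with [x] extract the coefficients on the independent vectors [x] and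
   [d]. *)
have F1 : (s1 - s2) *: cross x d = 0.
  transitivity (cross (s1 *: x + (s1 * tt i) *: d) d - cross (s2 *: x + (s2 * tt j) *: d) d).
    by rewrite /cross; apply: vec_ext; rewrite !coordE; ring.
  by rewrite E2 subrr.
have F2 : (s1 * tt i - s2 * tt j) *: cross x d = 0.
  transitivity (cross x (s1 *: x + (s1 * tt i) *: d) - cross x (s2 *: x + (s2 * tt j) *: d)).
    by rewrite /cross; apply: vec_ext; rewrite !coordE; ring.
  by rewrite E2 subrr.
move/eqP: F1; rewrite scaler_eq0 (negbTE kd) orbF subr_eq0 => /eqP s12.
move/eqP: F2; rewrite scaler_eq0 (negbTE kd) orbF s12 -mulrBr mulf_eq0 subr_eq0 (negbTE tij) orbF.
move=> /eqP s20; apply: aP; have := chain_vertex (f i).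
by rewrite E1 s12 s20 scale0r addr0.
Qed.

(** The hits are the zeros of the squared modulus of [chain_spin] along the segment: a nonempty
    compact set of parameters, which has a least element. *)
Lemma first_hit a m : ~ chain P a -> chain P m ->
  exists s, [/\ 0 < s <= 1, chain P (a + s *: (m - a)) &
    forall s', 0 <= s' < s -> ~ chain P (a + s' *: (m - a))].
Proof.
move=> aP mP.
pose line (s : R) : V := a + s *: (m - a).
have cl : vcontinuous line.
  by move=> s; apply: vcvgD; [exact: vcvg_cst | apply: vcvgZ; [exact: cvg_id | exact: vcvg_cst]].
pose N (s : R) := complex.Re (chain_spin n P (line s)) ^+ 2 +
  complex.Im (chain_spin n P (line s)) ^+ 2.
have cN : continuous N.
  have cc : ccontinuous (fun s => chain_spin n P (line s)).
    move=> s; apply: mcvg_tr; apply: mcvg_prod => k; apply: mcvg_spin.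
    by apply: vcvgB; [exact: vcvg_cst | exact: cl].
  move=> s; have [c1 c2] := cc s.
  by apply: cvgD; rewrite expr2; under eq_fun do rewrite expr2; exact: cvgM.
have N0 s : N s = 0 <-> chain P (line s).
  split=> [|h]; last by rewrite /N (chain_spin_eq0 Pn n0 h) /= expr0n addr0.
  rewrite /N => /eqP; rewrite paddr_eq0 ?sqr_ge0 // !sqrf_eq0 => /andP[/eqP z1 /eqP z2].
  apply: contrapT => /(chain_spin_neq0 Pn) /eqP; apply; exact: complex_ext.
pose A : set R := `[0, 1]%classic `&` (N @^-1` [set 0]).
have cA : compact A.
  apply: compact_closedI; first exact: segment_compact.
  by apply: preimage_closed => [x _|]; [exact: cN | exact: closed_eq].
have A1 : A 1.
  split; first by rewrite /= in_itv /= lexx ler01.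
  by apply/N0; rewrite /line scale1r addrC subrK.
have [s sA smin] := @compact_EVT_min R R id A (ex_intro _ _ A1) cA
  (continuous_subspaceT (fun x => @cvg_id _ _)).
move: sA; rewrite inE => -[/=]; rewrite in_itv /= => /andP[s0 s1] /N0 sP.
exists s; split=> //.
  rewrite s1 andbT lt_def s0 andbT; apply/eqP => z; apply: aP.
  by move: sP; rewrite /line z scale0r addr0.
move=> s' /andP[s'0 s's] h; suff : s <= s' by rewrite leNgt s's.
apply: smin; rewrite inE; split; last exact/N0.
by rewrite /= in_itv /= s'0 (le_trans (ltW s's) s1).
Qed.

End simple_chain.

Section meridian_loop.
Context {R : realType}.
Local Notation V := 'rV[R]_3.
Local Notation I := (unit_interval R).
Variables (n : nat) (P : nat -> V).
Hypothesis Pn : forall k, P (k + n.+1) = P k.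
Hypothesis n0 : (0 < n)%N.
Hypothesis simpleP : forall i j s t, 0 <= s < 1 -> 0 <= t < 1 ->
  (1 - s) *: P i + s *: P i.+1 = (1 - t) *: P j + t *: P j.+1 -> i = j %[mod n.+1].

(** The approach may be oblique. With [u = e + beta *: d], stepping back from the hit [q] by
    [kap *: u] moves the foot on the edge by [kap * beta] and leaves the edge by [kap *: e]; taking
    these as centre shift and radius makes the segment end exactly on the circle. *)
Lemma meridian_loop (a : V) : ~ chain P a -> exists sig cir : I -> V,
  [/\ vcontinuous sig, vcontinuous cir, sig zero = a & sig one = cir zero] /\
  [/\ cir one = cir zero, forall t, ~ chain P (sig t), forall t, ~ chain P (cir t) &
      rotates (fun t => chain_spin n P (cir t)) (pi *+ 2)].
Proof.
move=> aP; have [k0 kd] := exists_edge_off_line Pn n0 simpleP aP.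
have [tau tau01 gen] := exists_generic_target Pn aP kd.
set m := P k0 + tau *: (P k0.+1 - P k0) in gen.
have mP : chain P m.
  exists k0, tau; split; first by case/andP: tau01 => *; rewrite !ltW.
  by rewrite /m; apply: vec_ext; rewrite !coordE; ring.
have [s0 [s01 [k [la [la01 qE]]] before]] := first_hit Pn n0 aP mP.
set d := P k.+1 - P k; set q := a + s0 *: (m - a) in qE.
have qE' : q = P k + la *: d by rewrite qE /d; apply: vec_ext; rewrite !coordE; ring.
have qv j : q <> P j by move=> E; apply: (gen j s0); rewrite -E.
have [l0 l1] : 0 < la /\ la < 1.
  case/andP: la01 => l0 l1; split; rewrite lt_def ?l0 ?l1 andbT; apply/eqP => E.
    by apply: (qv k); rewrite qE' E scale0r addr0.
  by apply: (qv k.+1); rewrite qE' -E scale1r /d addrC subrK.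
have d0 : d != 0.
  rewrite subr_eq0; apply/eqP => E; apply: (@vertex_neq _ n P simpleP k k.+1) => //.
  by rewrite ltnSn -addn1 leq_add2l.
have dd : 0 < dot d d by rewrite lt_def dot_ge0 andbT; apply: contra_neq d0; exact: dot_eq0.
pose u := a - m; pose beta := dot u d / dot d d; pose e := u - beta *: d.
have [s0p s0l] : 0 < s0 /\ s0 <= 1 by apply/andP.
(* Were the approach along the line of the edge, either [a] would lie on the edge, or an endpoint of
   the edge would lie on the line through [a] and [m], against [gen]. *)
have e0 : e != 0.
  apply/eqP => E; have uE : u = beta *: d by apply/eqP; rewrite -subr_eq0 -/e E.
  have aE s : a + s *: (m - a) = P k + (la + (s0 - s) * beta) *: d.
    have -> : a + s *: (m - a) = q + (s0 - s) *: u.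
      by rewrite /q /u; apply: vec_ext; rewrite !coordE; ring.
    by rewrite qE' uE; apply: vec_ext; rewrite !coordE; ring.
  have aE0 : a = P k + (la + s0 * beta) *: d by rewrite -{1}[a]addr0 -(scale0r (m - a)) aE subr0.
  set mu := la + s0 * beta in aE0.
  have [mu0|mu0] := ltP mu 0.
    have b0 : beta < 0 by rewrite -(pmulr_rlt0 _ s0p); rewrite /mu in mu0; lra.
    apply: (gen k (s0 + la / beta)); rewrite aE.
    rewrite (_ : _ + _ * _ = 0) ?scale0r ?addr0 //.
    by field; rewrite lt_eqF.
  have [mu1|mu1] := leP mu 1.
    apply: aP; exists k, mu; rewrite mu0 mu1; split=> //.
    by rewrite aE0 /d; apply: vec_ext; rewrite !coordE; ring.
  have b0 : 0 < beta by rewrite -(pmulr_rgt0 _ s0p); rewrite /mu in mu1; lra.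
  apply: (gen k.+1 (s0 - (1 - la) / beta)); rewrite aE.
  rewrite (_ : _ + _ * _ = 1); first by rewrite scale1r /d addrC subrK.
  by field; rewrite gt_eqF.
have ed : dot e d = 0.
  rewrite (_ : dot e d = dot u d - beta * dot d d); last by rewrite /e /dot !coordE; ring.
  by rewrite /beta divfK ?subrr // gt_eqF.
have ne := nrm_gt0 e0; pose w := (nrm e)^-1 *: e.
have w1 : dot w w = 1 by rewrite /w dotZZ -nrm2; field; rewrite gt_eqF.
have wd : dot w d = 0.
  have -> : dot w d = (nrm e)^-1 * dot e d by rewrite /w /dot !coordE; ring.
  by rewrite ed mulr0.
have la01' : 0 < la < 1 by rewrite l0.
have [|eta eta0 Heta] := @meridian _ n P Pn k la w la01' d0 w1 wd.
  move=> j t kj /andP[t0 t1]; rewrite -/d -qE' => E.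
  have [tl|tl] := ltP t 1; last first.
    have t_1 : t = 1 by apply/eqP; rewrite eq_le t1.
    by apply: (qv j.+1); rewrite E t_1 subrr scale0r scale1r add0r.
  apply: (neq_mod kj); apply: (@simpleP _ _ la t); rewrite ?t0 ?l0 ?(ltW l0) //.
  by rewrite -E -qE.
(* The centre shift, the radius and the step [kap] are each at most [rho / 2]. This respects [eta],
   keeps [la'] inside the edge and [s1] positive. *)
pose rho := Num.min eta (Num.min (Num.min la (1 - la)) s0).
have rho0 : 0 < rho by rewrite !lt_min eta0 l0 subr_gt0 l1 s0p.
have [r1 r2 r3 r4] : [/\ rho <= eta, rho <= la, rho <= 1 - la & rho <= s0].
  by split; rewrite /rho !ge_min lexx ?orbT.
pose M := `|beta| + nrm e + 1.
have b_ge0 := normr_ge0 beta.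
have M1 : 1 <= M by rewrite /M; lra.
have Mp : 0 < M by lra.
pose kap := rho / 2 / M.
have kap0 : 0 < kap by rewrite !divr_gt0.
have kM : kap * M = rho / 2 by rewrite /kap divfK // gt_eqF.
have kap_b : kap * `|beta| <= rho / 2.
  by rewrite -kM; apply: ler_wpM2l; [exact: ltW | rewrite /M; lra].
have kap_e : kap * nrm e <= rho / 2.
  by rewrite -kM; apply: ler_wpM2l; [exact: ltW | rewrite /M; lra].
have kap_1 : kap <= rho / 2.
  by rewrite -kM -{1}[kap]mulr1; apply: ler_wpM2l; [exact: ltW |].
have kb : `|kap * beta| <= rho / 2 by rewrite normrM gtr0_norm.
have := kb; rewrite ler_norml => /andP[kb1 kb2].
pose la' := la + kap * beta; pose eps := kap * nrm e.
have la'01 : 0 < la' < 1 by rewrite /la'; apply/andP; split; lra.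
have eps0 : 0 < eps by rewrite mulr_gt0.
have [|| rot ne0] := Heta la' eps la'01.
- by rewrite /la' addrAC subrr add0r; lra.
- by rewrite eps0 /eps; lra.
pose s1 := s0 - kap.
have s1p : 0 < s1 by rewrite /s1; lra.
have chainP x : chain_spin n P x != 0 -> ~ chain P x.
  by move=> /eqP h /(chain_spin_eq0 Pn n0).
exists (fun t => a + (s1 * ival t) *: (m - a)), (fun t => circle (P k) d w la' eps (turn t)).
have end1 : a + s1 *: (m - a) = circle (P k) d w la' eps 0.
  rewrite /circle cos0 sin0 scale1r scale0r addr0 /eps /w scalerA mulfK ?gt_eqF //.
  have -> : a + s1 *: (m - a) = q + kap *: u.
    by rewrite /q /u /s1; apply: vec_ext; rewrite !coordE; ring.
  rewrite qE' /la' (_ : u = e + beta *: d); last by rewrite /e subrK.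
  by apply: vec_ext; rewrite !coordE; ring.
split; split.
- have cs : vcontinuous (fun r : R => a + (s1 * r) *: (m - a)).
    move=> r; apply: vcvgD; first exact: vcvg_cst.
    apply: vcvgZ; last exact: vcvg_cst.
    by apply: cvgM; [exact: cvg_cst | exact: cvg_id].
  exact: (vcontinuous_comp ival_continuous cs).
- exact: (vcontinuous_comp turn_continuous (@circle_continuous _ _ _ _ _ _)).
- by rewrite ival_zero mulr0 scale0r addr0.
- by rewrite ival_one mulr1 turn0.
- exact: circle_closed.
- move=> t; apply: before; rewrite mulr_ge0 ?ival_ge0 ?ltW //=.
  apply: le_lt_trans (_ : s1 < s0); last by rewrite /s1; lra.
  by rewrite ler_piMr ?ival_le1 // ltW.
- by move=> t; exact: chainP.
- exact: rot.
Qed.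

End meridian_loop.

(** * Knot complements *)

Section sphere_paths.
Context {R : realType}.
Local Notation S := (sphere R 3).
Local Notation V := 'rV[R]_3.
Local Notation I := (unit_interval R).

Lemma rV_continuous (T : topologicalType) m (f : T -> 'rV[R]_m) :
  (forall i, continuous (fun t => f t 0 i)) -> continuous f.
Proof.
move=> cf t A [B nB BA].
have : \forall t' \near t, forall i, B 0 i (f t' 0 i).
  by apply: filter_forall => i; exact: cf (nB 0 i).
by apply: filterS => t' h; apply: BA => i j; rewrite (ord1 i); exact: h.
Qed.

Lemma into_sphere_continuous (T : topologicalType) (f : T -> S) :
  continuous (fun t => ht (f t)) -> vcontinuous (fun t => hd (f t)) -> continuous f.
Proof.
move=> ct ch; apply: continuous_comp_initial; apply: rV_continuous => i.
have -> : i = @unsplit 3 1 (@fintype.split 3 1 i) by rewrite splitK.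
case: (@fintype.split 3 1 i) => j /=; last by rewrite (ord1 j); exact: ct.
have hE t : (set_val (f t) : 'rV[R]_4) 0 (lshift 1 j) = hd (f t) 0 j by rewrite mxE.
rewrite (_ : (fun t => _) = fun t => hd (f t) 0 j); last by apply/funext => t; exact: hE.
move=> t; have [cx cy cz] := ch t.
case: j {hE} => [[|[|[|//]]] jl].
- by rewrite (_ : Ordinal jl = Ordinal (isT : (0 < 3)%N)) //; exact: val_inj.
- by rewrite (_ : Ordinal jl = Ordinal (isT : (1 < 3)%N)) //; exact: val_inj.
- by rewrite (_ : Ordinal jl = Ordinal (isT : (2 < 3)%N)) //; exact: val_inj.
Qed.

Lemma stereographic_continuous (T : topologicalType) (f : T -> V) :
  vcontinuous f -> continuous (fun t => stereographic (f t)).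
Proof.
move=> cf.
have ci t : (dot (f t') (f t') + 1)^-1 @[t' --> t] --> (dot (f t) (f t) + 1)^-1.
  apply: cvgV; first exact: dot1_neq0.
  by apply: cvgD; [exact: vcvg_dot (cf t) (cf t) | exact: cvg_cst].
apply: into_sphere_continuous.
  rewrite (_ : (fun t => _) = fun t => (dot (f t) (f t) - 1) / (dot (f t) (f t) + 1)).
    move=> t; apply: cvgM; last exact: ci.
    by apply: cvgB; [exact: vcvg_dot (cf t) (cf t) | exact: cvg_cst].
  by apply/funext => t; rewrite ht_stereographic.
rewrite (_ : (fun t => _) = fun t => (2 / (dot (f t) (f t) + 1)) *: f t); last first.
  by apply/funext => s; rewrite hd_stereographic.
move=> t; apply: vcvgZ; last exact: cf.
by apply: cvgM; [exact: cvg_cst | exact: ci].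
Qed.

Let e3 : V := mkvec 0 0 1.

(* The point at infinity of the ray spanned by [e3], reached at parameter 0. *)
Definition pole_vec (r : R) : 'rV[R]_4 :=
  (1 + r ^+ 2)^-1 *: (row_mx ((2 * r) *: e3) (const_mx (1 - r ^+ 2) : 'rV[R]_1)).

Lemma pole_subproof (r : R) : pole_vec r \in sphere R 3.
Proof.
apply/mem_set; rewrite /sphere /= /pole_vec.
rewrite (sqnormZ (n := 3 + 1)) (sqnorm_row_mx (m := 3) (n := 1)) sqnormZ.
have -> : sqnorm (const_mx (1 - r ^+ 2) : 'rV[R]_1) = (1 - r ^+ 2) ^+ 2.
  by rewrite /sqnorm big_ord1 mxE.
rewrite sqnorm_dot /dot /e3 !coordE.
have r1 : 1 + r ^+ 2 != 0 by rewrite gt_eqF // ltr_pwDl ?sqr_ge0.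
by field.
Qed.

Definition pole_point (r : R) : S := exist (fun y => y \in sphere R 3) _ (pole_subproof r).

Lemma hd_pole r : hd (pole_point r) = (2 * r / (1 + r ^+ 2)) *: e3.
Proof.
rewrite /hd -[set_val _]/(pole_vec r) /pole_vec.
rewrite (@scale_row_mx _ 1 3 1) (@row_mxKl _ 1 3 1) scalerA.
by rewrite [_^-1 * _]mulrC.
Qed.

Lemma ht_pole r : ht (pole_point r) = (1 - r ^+ 2) / (1 + r ^+ 2).
Proof.
rewrite /ht -[set_val _]/(pole_vec r) /pole_vec mxE.
by rewrite (@row_mxEr _ 1 3 1) mxE mulrC.
Qed.

Lemma pole_continuous : continuous pole_point.
Proof.
have rr (r : R) : 1 + r ^+ 2 != 0 by rewrite gt_eqF // ltr_pwDl ?sqr_ge0.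
have c2 (r : R) : r' ^+ 2 @[r' --> r] --> r ^+ 2 by rewrite expr2; apply: cvgM; exact: cvg_id.
have ci (r : R) : (1 + r' ^+ 2)^-1 @[r' --> r] --> (1 + r ^+ 2)^-1.
  by apply: cvgV => //; apply: cvgD; [exact: cvg_cst | exact: c2].
apply: into_sphere_continuous.
  rewrite (_ : (fun r => _) = fun r => (1 - r ^+ 2) / (1 + r ^+ 2)).
    by move=> r; apply: cvgM (ci r); apply: cvgB; [exact: cvg_cst | exact: c2].
  by apply/funext => r; rewrite ht_pole.
rewrite (_ : (fun t => _) = fun t => (2 * t / (1 + t ^+ 2)) *: e3); last first.
  by apply/funext => s; rewrite hd_pole.
move=> r; apply: vcvgZ; last exact: vcvg_cst.
by apply: cvgM (ci r); apply: cvgM; [exact: cvg_cst | exact: cvg_id].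
Qed.

Lemma pole_stereographic r : r != 0 -> pole_point r = stereographic (r^-1 *: e3).
Proof.
move=> r0; have r1 : 1 + r ^+ 2 != 0 by rewrite gt_eqF // ltr_pwDl ?sqr_ge0.
have E : 1 - ht (pole_point r) = 2 * r ^+ 2 / (1 + r ^+ 2) by rewrite ht_pole; field.
apply: stereographic_eq.
  rewrite eq_sym -subr_eq0 E !mulf_neq0 ?invr_neq0 ?pnatr_eq0 ?expf_neq0 //.
rewrite hd_pole E scalerA; congr (_ *: _); field; rewrite r0 r1 //.
Qed.

Lemma ht_pole0 : ht (pole_point 0) = 1.
Proof. by rewrite ht_pole expr0n subr0 addr0 divr1. Qed.

Section chain.
Variables (n : nat) (P : nat -> V).
Hypothesis Pn : forall k, P (k + n.+1) = P k.

Lemma chain_bounded : exists2 B : R, 0 < B & forall x, chain P x -> nrm x < B.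
Proof.
have [k _ kmax] := exists_max (fun j => nrm (P j)) n.
have kmax' j : nrm (P j) <= nrm (P k).
  by rewrite -(periodic_mod Pn j); apply: kmax; rewrite -ltnS ltn_mod.
exists (nrm (P k) + 1); first by rewrite ltr_wpDl ?nrm_ge0.
move=> x [j [t [/andP[t0 t1] ->]]].
apply: le_lt_trans (nrmD _ _) _; rewrite !nrmZ ?subr_ge0 //.
have h1 := ler_wpM2l t0 (kmax' j.+1).
have t1' : 0 <= 1 - t by rewrite subr_ge0.
have h2 := ler_wpM2l t1' (kmax' j).
by move: (nrm (P j)) (nrm (P j.+1)) (nrm (P k)) h1 h2 => p q r h1 h2; lra.
Qed.

(** Parameter [t] is sent to distance [B / t] along a ray, so the path comes in from infinity
    without entering the ball that contains the polygon. *)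
Lemma pole_path : exists (f : I -> S) (a : V), [/\ continuous f,
  ht (f zero) = 1, f one = stereographic a, ~ chain P a &
  forall t, ~ (@stereographic R @` chain P) (f t)].
Proof.
have [B B0 hB] := chain_bounded.
pose f (t : I) := pole_point (B^-1 * ival t).
have far (r : R) : 0 < r <= 1 -> ~ chain P ((B^-1 * r)^-1 *: e3).
  move=> /andP[r0 r1] /hB; rewrite nrmZ; last by rewrite invr_ge0 mulr_ge0 ?invr_ge0 ?ltW.
  rewrite /nrm /dot /e3 !coordE !mulr0 !add0r mulr1 sqrtr1 mulr1 invfM invrK.
  suff h : B <= B / r by rewrite ltNge h.
  by rewrite ler_pdivlMr // ler_piMr // ltW.
exists f, ((B^-1 * 1)^-1 *: e3); split.
- have cB : continuous (fun t : I => B^-1 * ival t).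
    exact: (continuous_compose ival_continuous (@mulrl_continuous R B^-1)).
  exact: (continuous_compose cB pole_continuous).
- by rewrite /f ival_zero mulr0 ht_pole0.
- by rewrite /f ival_one pole_stereographic // mulr1 invr_neq0 // gt_eqF.
- by apply: far; rewrite ltr01 lexx.
move=> t [c cP E].
have [t0|t0] := eqVneq (ival t) 0.
  by move: (ht_stereographic_neq1 c); rewrite E /f t0 mulr0 ht_pole0 eqxx.
have tp : 0 < ival t <= 1 by rewrite lt_def t0 ival_ge0 ival_le1.
apply: (far _ tp).
have := E; rewrite /f pole_stereographic; last by rewrite mulf_neq0 // invr_neq0 // gt_eqF.
by move/stereographic_inj => <-.
Qed.

End chain.
End sphere_paths.

Section polygon_chain.
Context {R : realType}.
Local Notation V := 'rV[R]_3.
Variables (n : nat) (p : 'I_n.+1 -> V).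

Definition vertex (k : nat) : V := p (inord (k %% n.+1)).

Lemma vertex_periodic k : vertex (k + n.+1) = vertex k.
Proof. by rewrite /vertex modnDr. Qed.

Lemma vertex_succ k : vertex k.+1 = p (ordS (inord (k %% n.+1))).
Proof.
rewrite /vertex; congr p; apply: val_inj; rewrite /= !inordK ?ltn_mod //.
by rewrite -[in RHS]addn1 modnDml addn1.
Qed.

Lemma vertex_polygon k t :
  (1 - t) *: vertex k + t *: vertex k.+1 = polygon_point p (inord (k %% n.+1)) t.
Proof. by rewrite vertex_succ. Qed.

Lemma closed_polygon_chain : closed_polygon p = chain vertex.
Proof.
apply/seteqP; split=> x [].
  move=> i [t [t01 ->]]; exists i, t; split => //.
  by rewrite vertex_polygon modn_small // inord_val.
by move=> k [t [t01 ->]]; exists (inord (k %% n.+1)), t; rewrite vertex_polygon.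
Qed.

Lemma simple_chain : simple_polygon p -> forall i j s t, 0 <= s < 1 -> 0 <= t < 1 ->
  (1 - s) *: vertex i + s *: vertex i.+1 = (1 - t) *: vertex j + t *: vertex j.+1 ->
  i = j %[mod n.+1].
Proof.
move=> sp i j s t s01 t01; rewrite !vertex_polygon => /(sp _ _ _ _ s01 t01)[/(congr1 val) /=].
by rewrite !inordK ?ltn_mod.
Qed.

End polygon_chain.

Section conjugate_loop.
Context {R : realType} {X : topologicalType} (F : X -> R[i]).
Local Notation I := (unit_interval R).

(** The rotation along [p] is cancelled by the return, so a meridian can be moved to another base
    point. *)
Lemma rotates_conjugate (x y : X) (p : {path I from x to y}) (l : {path I from y to y}) a :
  ccontinuous F -> (forall v, F v != 0) -> rotates (fun t => F (l t)) a ->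
  exists l' : {path I from x to x}, rotates (fun t => F (l' t)) a.
Proof.
move=> cF F0 rl; have [b rp] : exists b, rotates (fun t => F (p t)) b.
  by apply: rotates_exists => //; exact: (ccontinuous_comp (@cts_fun _ _ p)).
exists (concat p (concat l (reverse p))).
rewrite (_ : a = b + (a + - b)); last by ring.
exact/rotates_concat/rotates_concat/rotates_reverse.
Qed.

End conjugate_loop.

Section complement.
Context {R : realType}.
Local Notation S := (sphere R 3).
Local Notation V := 'rV[R]_3.
Local Notation I := (unit_interval R).
Variables (K : set S) (n : nat) (P : nat -> V) (h k : S -> S).
Hypothesis Pn : forall j, P (j + n.+1) = P j.
Hypothesis n0 : (0 < n)%N.
Hypothesis simpleP : forall i j s t, 0 <= s < 1 -> 0 <= t < 1 ->
  (1 - s) *: P i + s *: P i.+1 = (1 - t) *: P j + t *: P j.+1 -> i = j %[mod n.+1].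
Hypotheses (ch : continuous h) (ck : continuous k) (hk : cancel h k) (kh : cancel k h).
Hypothesis hK : h @` K = @stereographic R @` chain P.
Local Notation U := (~` K).

(** [F] is evaluated on the polygonal side; the inverse [k] serves to bring paths back to the
    complement of [K]. *)
Let out (y : U) : S := h (set_val y).

Lemma out_continuous : continuous out.
Proof.
have cv : continuous (fun y : U => (set_val y : S)) by exact: initial_continuous.
exact: (continuous_compose cv ch).
Qed.

Lemma out_off_chain (y : U) : ~ (@stereographic R @` chain P) (out y).
Proof.
rewrite -hK => -[z Kz hz].
have : (~` K) (set_val y) := set_valP y.
by rewrite (_ : set_val y = z) //; apply: (can_inj hk).
Qed.

Lemma out_inj : injective out.
Proof. by move=> y z /(can_inj hk) E; exact: val_inj. Qed.

Lemma into_complement (z : S) : ~ (@stereographic R @` chain P) z -> k z \in U.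
Proof.
by move=> zP; apply/mem_set => Kz; apply: zP; rewrite -hK; exists (k z).
Qed.

Lemma lift_path (f : I -> S) : continuous f ->
  (forall t, ~ (@stereographic R @` chain P) (f t)) ->
  exists2 g : I -> U, continuous g & forall t, out (g t) = f t.
Proof.
move=> cf fP.
exists (fun t => exist (fun y => y \in U) _ (into_complement (fP t))).
  apply: continuous_comp_initial; exact: (continuous_compose cf ck).
by move=> t; rewrite /out -[set_val _]/(k (f t)) kh.
Qed.

Let F (y : U) : R[i] := sphere_spin n P (out y).

Lemma spin_out_continuous : ccontinuous F.
Proof.
move=> y; have [cr ci] := sphere_spin_continuous n (@out_off_chain y).
by split; [exact: (cvg_comp _ _ (@out_continuous y) cr) |
  exact: (cvg_comp _ _ (@out_continuous y) ci)].
Qed.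

Lemma spin_out_neq0 y : F y != 0.
Proof. by apply: sphere_spin_neq0 => //; exact: out_off_chain. Qed.

Lemma stereographic_off_chain a : ~ chain P a -> ~ (@stereographic R @` chain P) (stereographic a).
Proof. by move=> aP [b bP /stereographic_inj E]; apply: aP; rewrite -E. Qed.

Lemma odd_loop_finite (x : U) a : out x = stereographic a ->
  exists l : {path I from x to x}, rotates (fun t => F (l t)) (pi *+ 2).
Proof.
move=> xa.
have aP : ~ chain P a by move=> aP; apply: (@out_off_chain x); rewrite xa; exists a.
have [sig [cir [[csig ccir sig0 sig1] [cir1 sigP cirP rot]]]] := meridian_loop Pn n0 simpleP aP.
have [g1 cg1 g1E] := lift_path (stereographic_continuous csig)
  (fun t => stereographic_off_chain (sigP t)).
have [g2 cg2 g2E] := lift_path (stereographic_continuous ccir)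
  (fun t => stereographic_off_chain (cirP t)).
have g10 : g1 zero = x by apply: out_inj; rewrite g1E sig0 xa.
have g11 : g1 one = g2 zero by apply: out_inj; rewrite g1E g2E sig1.
have g21 : g2 one = g2 zero by apply: out_inj; rewrite !g2E cir1.
pose p1 : {path I from x to g2 zero} := mk_path cg1 g10 g11.
pose p2 : {path I from g2 zero to g2 zero} := mk_path cg2 erefl g21.
apply: (rotates_conjugate p1 (l := p2)); [exact: spin_out_continuous | exact: spin_out_neq0 |].
apply: rotates_scale rot => t.
have [r r0 E] := sphere_spin_stereographic n (cirP t).
by exists r => //; rewrite -E /F -[p2 t]/(g2 t) g2E.
Qed.

Lemma odd_loop (x : U) :
  exists l : {path I from x to x}, rotates (fun t => F (l t)) (pi *+ 2).
Proof.
have [x1|x1] := eqVneq (ht (out x)) 1; last first.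
  by have [a xa] := stereographic_surj x1; exact: odd_loop_finite xa.
have [f [a [cf f0 f1 aP fP]]] := pole_path Pn.
have [g cg gE] := lift_path cf fP.
have g0 : g zero = x.
  (* At height 1 the equation of the sphere forces [hd] to vanish, so there is only one point at
     infinity. *)
  apply: out_inj; rewrite gE; apply: sphere_ext; last by rewrite f0 x1.
  have hd0 (y : S) : ht y = 1 -> hd y = 0.
    by move=> y1; apply: dot_eq0; have := sphereE y; rewrite y1; lra.
  by rewrite !hd0.
pose p : {path I from x to g one} := mk_path cg g0 erefl.
have [l rl] : exists l : {path I from g one to g one}, rotates (fun t => F (l t)) (pi *+ 2).
  by apply: (@odd_loop_finite _ a); rewrite gE.
by apply: (rotates_conjugate p (l := l)) => //; [exact: spin_out_continuous | exact: spin_out_neq0].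
Qed.

Lemma complement_brace (x : U) :
  exists circ : fundamental_group R x -> fundamental_group R x -> fundamental_group R x,
    nontrivial_skew_left_brace circ.
Proof.
have [l rl] := odd_loop x.
exact: (odd_rotation_brace spin_out_continuous spin_out_neq0 rl).
Qed.

End complement.

Theorem proposition5p14 (R : realType) (K : set (sphere R 3)) (x : ~` K)
    (tameK : tame_knot K) :
  exists circ : knot_group x -> knot_group x -> knot_group x,
    nontrivial_skew_left_brace circ.
Proof.
have [_ [Q [h [[m [p [m3 sp QE]]] [ch [k [ck hk kh]]] hK]]]] := tameK.
case: m p m3 sp QE => [//|n] p n2 sp QE.
rewrite QE closed_polygon_chain in hK.
exact: (complement_brace (vertex_periodic p) (ltnW n2) (simple_chain sp) ch ck hk kh hK).
Qed.
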